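(* Let $a_1,a_2,\ldots$ be i.i.d. random cost vectors in $\mathbb{R}^d$ with $\mathbb{E}[a_i]=a$, and suppose that for constants $L_2,R_2>0$ all $\|a_i\|\le L_2$ and $\|a_i-a\|\le R_2$. Let $x_1,x_2,\ldots$ be the actions of the Anytime Subgradient Algorithm with parameter $\eta>0$ run on the simplex $\mathcal{S}$ with these cost vectors, let $x^*\in\arg\min_{x\in\mathcal{S}} a\cdot x$, and let $\Delta=\min\{\Delta_j:\Delta_j>0\}$. Then $$\mathbb{E}\left[\sum_{i=1}^\infty a\cdot(x_i-x^* )\right]\le \sqrt2\,L_2+\frac{(1+2\eta^2L_2^2)L_2}{6}+\frac{3/\eta^2+6L_2^2+72R_2^2\,e^{-1/(2\eta^2R_2^2)}}{\Delta}.$$ In particular, for $\eta=1/(2L_2)$, $$\mathbb{E}\left[\sum_{i=1}^\infty a\cdot(x_i-x^* )\right]\le 2L_2+\frac{18L_2^2+72R_2^2}{\Delta}.$$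
   Context: $\|\cdot\|$ is the Euclidean norm on $\mathbb{R}^d$, $e_1,\ldots,e_d$ are the coordinate vectors, and $\mathcal{S}=\{x\in\mathbb{R}^d: x(j)\ge 0 \text{ for all } j,\ \sum_{j=1}^d x(j)=1\}$ is the simplex. For a compact convex set $\mathcal{X}\subset\mathbb{R}^d$, $P_{\mathcal{X}}(y)$ is the Euclidean projection of $y$ onto $\mathcal{X}$. Anytime Subgradient Algorithm on $\mathcal{X}$ with parameter $\eta>0$ and cost vectors $a_1,a_2,\ldots$: $x_1=P_{\mathcal{X}}(0)$, and for $n\ge2$, $x_n=P_{\mathcal{X}}(y_n)$ where $y_n=-\eta\,\frac{a_1+\cdots+a_{n-1}}{\sqrt{n-1}}$. The suboptimality gaps are $\Delta_j=a\cdot e_j-\min_{k}a\cdot e_k$ for $j=1,\ldots,d$; it is assumed that at least one $\Delta_j$ is positive, so that $\Delta$ is defined. *)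

(* Defs.v *)
From HB Require Import structures.
From mathcomp Require Import all_boot all_order all_algebra finmap.
From mathcomp Require Import all_classical all_reals all_analysis.

Set Implicit Arguments.
Unset Strict Implicit.
Unset Printing Implicit Defensive.

Import Order.TTheory GRing.Theory Num.Theory.
Import numFieldNormedType.Exports.

Local Open Scope classical_set_scope.
Local Open Scope ring_scope.

Section Borel_rV.
Context (R : realType) (d : nat).

(* The Borel sigma-algebra of R^d, presented as the product sigma-algebra,
   i.e., generated by the coordinate maps (as the library does for tuples). *)
Let coords (j : 'I_d) (v : 'rV[R]_d) : R := v 0 j.

Let rV_set0 : g_sigma_preimage coords set0.
Proof. exact: sigma_algebra0. Qed.

Let rV_setC A : g_sigma_preimage coords A -> g_sigma_preimage coords (~` A).
Proof. exact: sigma_algebraC. Qed.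

Let rV_bigcup (F : _^nat) : (forall i, g_sigma_preimage coords (F i)) ->
  g_sigma_preimage coords (\bigcup_i (F i)).
Proof. exact: sigma_algebra_bigcup. Qed.

HB.instance Definition _ := @isMeasurable.Build
  (measure_tuple_display default_measure_display) 'rV[R]_d
  (g_sigma_preimage coords) rV_set0 rV_setC rV_bigcup.

End Borel_rV.

Section euclidean.
Context (R : realType) (d : nat).
Implicit Types (u v x y a : 'rV[R]_d) (X : set 'rV[R]_d).

Definition dotp u v : R := \sum_(j < d) u 0 j * v 0 j.

(* The library norm `|u| on 'rV[R]_d is the sup norm, not this one. *)
Definition enorm u : R := Num.sqrt (dotp u u).

Definition coord_vec (j : 'I_d) : 'rV[R]_d := delta_mx 0 j.

Definition simplex : set 'rV[R]_d :=
  [set x | (forall j, 0 <= x 0 j) /\ \sum_(j < d) x 0 j = 1].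

Definition argmin X (f : 'rV[R]_d -> R) : set 'rV[R]_d :=
  [set x | X x /\ forall y, X y -> f x <= f y].

(* Unspecified when no nearest point exists; on a nonempty compact convex X
   the nearest point exists and is unique. *)
Definition proj X y : 'rV[R]_d := get (argmin X (fun z => enorm (y - z))).

(* Indices are shifted by one: [a n] is the cost vector a_{n+1} and
   [anytime_subgradient X eta a n] is the action x_{n+1}. *)
Definition anytime_subgradient X (eta : R) (a : nat -> 'rV[R]_d) (n : nat) :
    'rV[R]_d :=
  if n is 0%N then proj X 0
  else proj X (- (eta *: ((Num.sqrt n%:R)^-1 *: \sum_(i < n) a i))).

(* The least element of S; unspecified if there is none. *)
Definition minimum (S : set R) : R := get [set m | S m /\ lbound S m].

Definition gap a (j : 'I_d) : R :=
  dotp a (coord_vec j) - minimum [set dotp a (coord_vec k) | k in [set: 'I_d]].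

Definition min_gap a : R := minimum [set gap a j | j in [set j | 0 < gap a j]].

End euclidean.

Arguments simplex {R d}.

Section iid.
Context {disp disp' : measure_display} {T : measurableType disp}
  {T' : measurableType disp'} {R : realType} (P : probability T R).
Local Open Scope ereal_scope.

Definition mutually_independent (A : nat -> {RV P >-> T'}) : Prop :=
  forall (J : {fset nat}) (B : nat -> set T'), (forall i, measurable (B i)) ->
  P (\bigcap_(i in [set` J]) (A i @^-1` B i)) = \prod_(i <- J) P (A i @^-1` B i).

Definition identically_distributed (A : nat -> {RV P >-> T'}) : Prop :=
  forall (i j : nat) (B : set T'), measurable B ->
  distribution P (A i) B = distribution P (A j) B.

Definition iid (A : nat -> {RV P >-> T'}) : Prop :=
  mutually_independent A /\ identically_distributed A.

End iid.

(* Main.v *)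
Require Import Defs.
From HB Require Import structures.
From mathcomp Require Import all_boot all_order all_algebra finmap.
From mathcomp Require Import all_classical all_reals all_analysis.
From mathcomp Require Import measurable_realfun.
From mathcomp Require Import ring lra.

(** Write alpha = 1 / eta, rho = min (L2, R2), and for n >= 1 let G be the sum
    of the first n centered costs, so that the point projected at time n + 1 is
    - eta sqrt n a - (eta / sqrt n) G.  Let D be the regret <a, x - xstar> of
    the projected point x.

    Pathwise bound.  Comparing x with the point obtained by moving its
    suboptimal mass delta to an optimal vertex gives, by the variational
    inequality of the projection ([proj_simplex_regret]),
    Delta delta <= D <= delta ((1 - delta) r + V), where r = alpha / sqrt n is
    a bias and V = sqrt 2 |G| / n a noise.  Hence D <= r / 4 + V and
    D <= (r + V)^2 / (4 r) always; and when r is well below Delta, D is nonzero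
    only if V is of order at least Delta, in which case D is at most a constant
    times V^4 / Delta^3 ([regret_le_quartic]).  None of this depends on the
    dimension.

    Moments.  Since G is independent of the next cost, induction on n gives
    E |G|^2 <= n rho^2 and E |G|^4 <= 3 n^2 rho^4 ([second_moment_sum],
    [fourth_moment_sum]).  Here rho may be taken to be L2 as well as R2, as
    centering does not increase the second moment.  Thus the mean of V is of
    order rho / sqrt n and that of V^4 of order rho^4 / n^2.

    Summation.  The expected regret of a round is at most C / sqrt n, and for
    n > X = ((alpha + s) / Delta)^2 also at most B / n^2 with B of order
    1 / Delta^3, so that the sum is at most 2 C sqrt X + B / X, of order
    1 / Delta ([sum_two_regimes], [step_bounds]).  The margin s is a
    multiple of rho that is tuned to the claimed constants: if alpha <= 2 rho,
    the exponential factor is at least exp (-2) and its term helps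
    ([short_horizon_budget]); otherwise 3 alpha^2 is already large enough
    ([long_horizon_budget]).  The first round contributes sqrt 2 L2.

    The regret is never shown to be measurable: it is dominated by polynomials
    in |G|^2, and the integral of a nonnegative function is monotone in any case
    ([integral_series_le]).  The second inequality is the first one at
    eta = 1 / (2 L2), where the exponential is bounded by 1. *)

Set Implicit Arguments.
Unset Strict Implicit.
Unset Printing Implicit Defensive.

Import Order.TTheory GRing.Theory Num.Theory.
Import numFieldNormedType.Exports.

Local Open Scope classical_set_scope.
Local Open Scope ring_scope.

(** * The Euclidean scalar product *)

Section dot_product.
Context (R : realType) (d : nat).
Implicit Types (u v w x y z a g : 'rV[R]_d).

Lemma dotpC u v : dotp u v = dotp v u.
Proof. by apply: eq_bigr => j _; rewrite mulrC. Qed.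

Lemma dotpDl u v w : dotp (u + v) w = dotp u w + dotp v w.
Proof. by rewrite -big_split; apply: eq_bigr => j _; rewrite mxE mulrDl. Qed.

Lemma dotpZl (k : R) u v : dotp (k *: u) v = k * dotp u v.
Proof. by rewrite mulr_sumr; apply: eq_bigr => j _; rewrite mxE mulrA. Qed.

Lemma dotpNl u v : dotp (- u) v = - dotp u v.
Proof. by rewrite -scaleN1r dotpZl mulN1r. Qed.

Lemma dotpDr u v w : dotp u (v + w) = dotp u v + dotp u w.
Proof. by rewrite dotpC dotpDl !(dotpC u). Qed.

Lemma dotpZr (k : R) u v : dotp u (k *: v) = k * dotp u v.
Proof. by rewrite dotpC dotpZl dotpC. Qed.

Lemma dotpNr u v : dotp u (- v) = - dotp u v.
Proof. by rewrite dotpC dotpNl dotpC. Qed.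

Lemma dotp_ge0 u : 0 <= dotp u u.
Proof. by apply: sumr_ge0 => j _; rewrite -expr2 sqr_ge0. Qed.

Lemma enorm_ge0 u : 0 <= enorm u.
Proof. exact: sqrtr_ge0. Qed.

Lemma sqr_enorm u : enorm u ^+ 2 = dotp u u.
Proof. by rewrite sqr_sqrtr // dotp_ge0. Qed.

(** The polynomial k |-> dotp (k u + v) (k u + v) is nonnegative; its value at
    its vertex gives the inequality when dotp u u is not 0, and otherwise it is
    affine in k, so that its slope vanishes. *)
Lemma cauchy_schwarz u v : `|dotp u v| <= enorm u * enorm v.
Proof.
rewrite -ler_sqr ?nnegrE ?normr_ge0 ?mulr_ge0 ?enorm_ge0//.
rewrite exprMn !sqr_enorm real_normK ?num_real//.
have H (k : R) : 0 <= k ^+ 2 * dotp u u + 2 * k * dotp u v + dotp v v.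
  have := dotp_ge0 (k *: u + v).
  rewrite dotpDl !dotpDr !dotpZl !dotpZr (dotpC v u); lra.
have [u0|u0] := eqVneq (dotp u u) 0; last first.
  have u_gt0 : 0 < dotp u u by rewrite lt_def u0 dotp_ge0.
  have := H (- dotp u v / dotp u u).
  rewrite -(pmulr_rge0 _ u_gt0) -[_ ^+ 2 <= _]subr_ge0.
  by rewrite [X in 0 <= X -> _](_ : _ = dotp u u * dotp v v - dotp u v ^+ 2) //;
    field.
have [->|p0] := eqVneq (dotp u v) 0; first by rewrite u0 expr0n mul0r.
have := H (- (dotp v v + 1) / dotp u v); have := dotp_ge0 v.
by rewrite u0 -mulrA mulfVK//; lra.
Qed.

Lemma normr_coord_le_enorm u j : `|u 0 j| <= enorm u.
Proof.
rewrite -ler_sqr ?nnegrE ?enorm_ge0// sqr_enorm real_normK ?num_real//.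
rewrite /dotp (bigD1 j)//= -expr2 lerDl; apply: sumr_ge0 => i _.
by rewrite -expr2 sqr_ge0.
Qed.

Lemma dotp_coord_vec u j : dotp u (coord_vec R j) = u 0 j.
Proof.
rewrite /dotp (bigD1 j)//= mxE !eqxx mulr1 big1 ?addr0// => i ij.
by rewrite mxE (negPf ij) andbF mulr0.
Qed.

End dot_product.

(** * Projection onto the simplex *)

Section simplex_projection.
Context (R : realType) (d : nat).
Implicit Types (u v w x y z a g : 'rV[R]_d).

Lemma coord_vec_simplex (j : 'I_d) : simplex (coord_vec R j).
Proof.
split=> [i|]; first by rewrite mxE ler0n.
rewrite (bigD1 j)//= mxE !eqxx big1 ?addr0// => i ij.
by rewrite mxE (negPf ij) andbF.
Qed.

Lemma simplex_le1 x j : simplex x -> x 0 j <= 1.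
Proof.
move=> [x0 <-]; rewrite (bigD1 j)//= lerDl; exact: sumr_ge0.
Qed.

Lemma simplex_segment x z (t : R) : simplex x -> simplex z -> 0 <= t <= 1 ->
  simplex (x + t *: (z - x)).
Proof.
move=> [x0 x1] [z0 z1] /andP[t0 t1]; split=> [j|].
  by rewrite !mxE; have := x0 j; have := z0 j; nra.
transitivity ((1 - t) * \sum_(j < d) x 0 j + t * \sum_(j < d) z 0 j).
  rewrite !mulr_sumr -big_split; apply: eq_bigr => j _.
  by rewrite !mxE/=; ring.
by rewrite x1 z1; ring.
Qed.

Lemma simplex_diameter x z : simplex x -> simplex z ->
  dotp (x - z) (x - z) <= 2.
Proof.
move=> sx sz.
apply: (@le_trans _ _ (\sum_(j < d) (x 0 j + z 0 j))); last first.
  by rewrite big_split/= sx.2 sz.2; lra.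
apply: ler_sum => j _; rewrite !mxE.
have := simplex_le1 j sx; have := simplex_le1 j sz.
have := sx.1 j; have := sz.1 j; nra.
Qed.

Lemma dotp_continuous (f h : 'rV[R]_d -> 'rV[R]_d) :
  (forall j, continuous (fun x => f x 0 j)) ->
  (forall j, continuous (fun x => h x 0 j)) ->
  continuous (fun x => dotp (f x) (h x)).
Proof.
move=> cf ch; apply: continuous_big => [|j _ x]; first exact: add_continuous.
by apply: continuousM; [exact: cf|exact: ch].
Qed.

Lemma compact_simplex : compact (@simplex R d).
Proof.
apply: bounded_closed_compact.
  exists 1; split => // M M1 x sx; rewrite /=.
  rewrite /Num.norm/= mx_normrE; apply: bigmax_le; first by apply: ltW; lra.
  move=> [i j] _ /=; rewrite ord1 ger0_norm ?sx.1//.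
  by apply: (le_trans (simplex_le1 j sx)); exact: ltW.
have -> : @simplex R d = (\bigcap_j [set x | 0 <= x 0 j]) `&`
    [set x | \sum_(j < d) x 0 j = 1].
  apply/seteqP; split=> x [xa xb]; split => //; first by move=> j _; exact: xa.
  by move=> j; exact: (xa j).
apply: closedI.
  apply: closed_bigI => j _.
  apply: (preimage_closed (f := fun x : 'rV[R]_d => x 0 j) _ (@closed_ge _ 0)).
  by move=> x _; exact: coord_continuous.
apply: (preimage_closed (f := fun x : 'rV[R]_d => \sum_(j < d) x 0 j) _
  (@closed_eq _ 1)) => x _; move: x.
apply: continuous_big => [|j _]; first exact: add_continuous.
exact: coord_continuous.
Qed.

(** A nearest point exists by compactness, so the choice made in the definition
    of the projection is a legitimate one. *)
Lemma proj_simplexP y : (exists x : 'rV[R]_d, simplex x) ->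
  argmin simplex (fun z => enorm (y - z)) (Defs.proj simplex y).
Proof.
move=> [x0 sx0]; rewrite /Defs.proj.
have [||c cX cmin] := @compact_EVT_min _ R (fun z => enorm (y - z))
  simplex _ compact_simplex.
- by exists x0.
- apply: continuous_subspaceT => z.
  apply: (continuous_comp (f := fun z => dotp (y - z) (y - z))); last first.
    exact: sqrt_continuous.
  move: z.
  have cc (j : 'I_d) : continuous (fun x : 'rV[R]_d => (y - x) 0 j).
    move=> x; rewrite (_ : (fun x => _) = (fun x : 'rV[R]_d => y 0 j - x 0 j)).
      by apply: continuousB; [exact: cst_continuous|exact: coord_continuous].
    by apply/funext => v; rewrite !mxE.
  by apply: dotp_continuous.
apply: (getPex (P := argmin simplex (fun z => enorm (y - z)))).
exists c; split; first by rewrite inE in cX.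
by move=> z sz; apply: cmin; rewrite inE.
Qed.

(** The variational inequality: moving from x by a fraction t towards z does
    not bring it closer to y, that is 2 t <y - x, z - x> <= t^2 |z - x|^2 for
    every t in [0, 1], which is false for some small t if the left-hand scalar
    product is positive. *)
Lemma proj_simplex_var y x z :
  argmin simplex (fun z => enorm (y - z)) x -> simplex z ->
  dotp (y - x) (z - x) <= 0.
Proof.
move=> [sx xmin] sz; set v := z - x; set u := y - x.
have H (t : R) : 0 <= t <= 1 -> 2 * t * dotp u v <= t ^+ 2 * dotp v v.
  move=> t01; have := xmin _ (simplex_segment sx sz t01).
  rewrite /enorm ler_sqrt ?dotp_ge0// opprD addrA -/u -/v.
  move: u v {xmin} => u v.
  rewrite dotpDl !dotpDr !(dotpNl, dotpNr, dotpZl, dotpZr) (dotpC v u).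
  lra.
rewrite leNgt; apply/negP => uv.
have vv := dotp_ge0 v.
have p0 : 0 < dotp v v + dotp u v by lra.
have := H (dotp u v / (dotp v v + dotp u v)).
rewrite divr_ge0 ?(ltW uv) ?(ltW p0)// ler_pdivrMr// mul1r lerDr vv => /(_ isT).
(* t = <u, v> / (|v|^2 + <u, v>) is at most 1 and small enough to refute H *)
set t := _ / _.
have t_gt0 : 0 < t by rewrite divr_gt0.
have tE : t * (dotp v v + dotp u v) = dotp u v by rewrite mulfVK// gt_eqF.
nra.
Qed.

End simplex_projection.

(** * Regret of a projected point *)

Section regret_of_projection.
Context (R : realType) (d : nat).
Implicit Types (x y a g : 'rV[R]_d).

Lemma simplex_regretE a x k : simplex x ->
  dotp a x - a 0 k = \sum_(j < d) (a 0 j - a 0 k) * x 0 j.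
Proof.
move=> [_ x1]; rewrite -[X in _ - X]mulr1 -x1 mulr_sumr -sumrB.
by apply: eq_bigr => j _; rewrite mulrBl.
Qed.

(** Here y = - eta s a - (eta / s) g with s the square root of the number of
    rounds and g the sum of the centered costs, delta is the mass that x puts on
    suboptimal vertices, and the regret D = <a, x> - a_k lies between
    Delta delta and a bound that is delta times a bias plus a noise term.
    For the upper bound, apply the variational inequality to the point z
    obtained from x by moving that mass to the optimal vertex k: the vector
    v = z - x satisfies <a, v> = - D, |v|^2 <= 2 delta^2 and
    <x, v> <= delta x_k <= delta (1 - delta).  Nothing depends on the dimension,
    and both bounds are multiples of delta: this forces D <= 0 as soon as the
    noise is smaller than Delta minus the bias. *)
Lemma proj_simplex_regret a g k (Delta s eta : R) x :
  (forall j, a 0 k <= a 0 j) ->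
  (forall j, a 0 k < a 0 j -> Delta <= a 0 j - a 0 k) ->
  0 < s -> 0 < eta ->
  argmin simplex
    (fun z => enorm (- ((eta * s) *: a) - (eta / s) *: g - z)) x ->
  exists delta, [/\ 0 <= delta <= 1,
    Delta * delta <= dotp a x - a 0 k &
    dotp a x - a 0 k <= delta *
      ((1 - delta) * (eta^-1 / s) + Num.sqrt (2 * dotp g g) / s ^+ 2)].
Proof.
move=> ak_min ak_gap s_gt0 eta_gt0 argx; have sx := argx.1.
pose J := [pred j | a 0 k < a 0 j].
have aJ j : ~~ J j -> a 0 j = a 0 k.
  by rewrite /= -leNgt => jk; apply/eqP; rewrite eq_le jk ak_min.
have kJ : ~~ J k by rewrite /= ltxx.
pose delta := \sum_(j < d | J j) x 0 j.
have delta_ge0 : 0 <= delta by apply: sumr_ge0 => j _; exact: sx.1.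
have delta_xk : delta + x 0 k <= 1.
  rewrite -sx.2 (bigID J)/= lerD2l (bigD1 k)//= lerDl.
  by apply: sumr_ge0 => j _; exact: sx.1.
have xk_ge0 := sx.1 k.
set D := dotp a x - a 0 k.
have DE : D = \sum_(j < d | J j) (a 0 j - a 0 k) * x 0 j.
  rewrite /D simplex_regretE// (bigID J)/= [X in _ + X]big1 ?addr0// => j jJ.
  by rewrite aJ// subrr mul0r.
have D_ge : Delta * delta <= D.
  rewrite DE mulr_sumr; apply: ler_sum => j jJ.
  by rewrite ler_wpM2r ?sx.1// ak_gap.
exists delta; split=> //; first by rewrite delta_ge0/=; lra.
(* z is x with the mass that it puts on J moved to k *)
pose z : 'rV[R]_d := \row_j (if J j then 0 else
  if j == k then x 0 k + delta else x 0 j).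
pose v := z - x.
have vE j :
    v 0 j = if a 0 k < a 0 j then - x 0 j else if j == k then delta else 0.
  rewrite !mxE /=; case: ifP => _; first by rewrite add0r.
  by case: eqVneq => [->|_]; rewrite ?subrr// addrAC subrr add0r.
have sum_v (f : 'I_d -> R) : \sum_(j < d) f j * v 0 j =
    f k * delta - \sum_(j < d | J j) f j * x 0 j.
  rewrite (bigID J)/= addrC (bigD1 k)//= vE ltxx eqxx.
  rewrite [X in _ + X + _]big1 ?addr0; last first.
    by move=> j /andP[/negPf jJ /negPf jk]; rewrite vE jJ jk mulr0.
  by congr (_ + _); rewrite -sumrN; apply: eq_bigr => j jJ; rewrite vE jJ mulrN.
have sz : simplex z.
  split=> [j|].
    by rewrite mxE; case: ifP => // _; case: ifP => _; rewrite ?sx.1// addr_ge0.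
  have := sum_v (fun=> 1); rewrite mul1r -/delta.
  under eq_bigr do rewrite mul1r.
  under [in X in _ - X]eq_bigr do rewrite mul1r.
  rewrite subrr /v; under eq_bigr do rewrite mxE [X in _ + X]mxE.
  by rewrite big_split/= sumrN sx.2 => /eqP; rewrite subr_eq0 => /eqP.
have av : dotp a v = - D.
  rewrite /dotp sum_v DE; under [in RHS]eq_bigr do rewrite mulrBl.
  by rewrite sumrB -mulr_sumr -/delta opprB.
have xJ2 : 0 <= \sum_(j < d | J j) x 0 j * x 0 j <= delta.
  rewrite sumr_ge0/=; last by move=> j _; rewrite mulr_ge0 ?sx.1.
  by apply: ler_sum => j _; rewrite ler_piMr ?sx.1// simplex_le1.
have xJ2' : \sum_(j < d | J j) x 0 j * x 0 j <= delta ^+ 2.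
  rewrite expr2 {1}/delta mulr_suml; apply: ler_sum => j jJ.
  rewrite ler_wpM2l ?sx.1// /delta (bigD1 j)//= lerDl.
  by apply: sumr_ge0 => i _; exact: sx.1.
have xv : dotp x v <= delta * (1 - delta).
  by rewrite /dotp sum_v; nra.
have vv : dotp v v <= 2 * delta ^+ 2.
  rewrite /dotp sum_v vE ltxx eqxx -sumrN.
  under eq_bigr => j /= jJ do rewrite vE jJ mulNr opprK.
  by rewrite mulr2n mulrDl mul1r lerD2l.
have gv : dotp g v <= Num.sqrt (2 * dotp g g) * delta.
  apply: le_trans (ler_norm _) _.
  apply: le_trans (cauchy_schwarz _ _) _.
  rewrite -ler_sqr ?nnegrE ?mulr_ge0 ?enorm_ge0 ?sqrtr_ge0//.
  rewrite !exprMn !sqr_enorm sqr_sqrtr ?mulr_ge0 ?dotp_ge0//.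
  have := ler_wpM2l (dotp_ge0 g) vv; lra.
have := proj_simplex_var argx sz; rewrite -/v.
rewrite !dotpDl !dotpNl !dotpZl av => H.
have {}H : eta * s * D <= delta * (1 - delta) +
    (eta / s) * (Num.sqrt (2 * dotp g g) * delta).
  have : eta / s * dotp g v <= eta / s * (Num.sqrt (2 * dotp g g) * delta).
    by rewrite ler_wpM2l// divr_ge0 ?ltW.
  lra.
rewrite -(ler_pM2l (mulr_gt0 eta_gt0 s_gt0)); apply: (le_trans H).
rewrite le_eqVlt; apply/orP; left; apply/eqP.
field.
by rewrite !gt_eqF.
Qed.

(** In the next three lemmas r is the bias and V the noise of
    [proj_simplex_regret].  The first two eliminate delta by maximizing over
    it: delta (1 - delta) <= 1 / 4, then the exact maximum of the quadratic. *)
Lemma regret_le_bias (delta r V D : R) : 0 <= delta <= 1 -> 0 <= r -> 0 <= V ->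
  D <= delta * ((1 - delta) * r + V) -> D <= r / 4 + V.
Proof.
move=> /andP[d0 d1] r0 V0 /le_trans; apply.
have : 0 <= (delta - 1 / 2) ^+ 2 * r by rewrite mulr_ge0 ?sqr_ge0.
have : delta * V <= V by rewrite ler_piMl.
nra.
Qed.

Lemma regret_le_square (delta r V D : R) : 0 < r ->
  D <= delta * ((1 - delta) * r + V) -> D <= (r + V) ^+ 2 / (4 * r).
Proof.
move=> r0 /le_trans; apply; rewrite ler_pdivlMr ?mulr_gt0//.
have := sqr_ge0 (2 * r * delta - (r + V)); nra.
Qed.

(** When the bias r is at most the fraction alpha / (alpha + s) of Delta, a
    positive regret requires the noise V to exceed the remaining fraction
    s / (alpha + s) of Delta; multiplying the bound on D by the third power of
    the ratio of V to this threshold, which is at least 1, yields a bound by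
    V ^ 4.  The fourth power matters: V has size 1 / sqrt n, and the series of
    the 1 / n ^ 2 converges, unlike the one that the second power would give. *)
Lemma regret_le_quartic (delta r V D Delta alpha s : R) :
  0 <= delta <= 1 -> 0 <= r -> 0 <= V -> 0 < Delta -> 0 <= alpha -> 0 < s ->
  r * (alpha + s) <= alpha * Delta ->
  Delta * delta <= D -> D <= delta * ((1 - delta) * r + V) ->
  D <= (1 + alpha / (4 * s)) * ((alpha + s) / (s * Delta)) ^+ 3 * V ^+ 4.
Proof.
move=> d01 r0 V0 De0 al0 s0 rD De_le D_le.
have [d0 d1] := andP d01.
have c0 : 0 < alpha + s by rewrite ltr_wpDl.
have c_ge0 := ltW c0; have s_ge0 := ltW s0; have De_ge0 := ltW De0.
have k_ge0 : 0 <= 1 + alpha / (4 * s).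
  by rewrite addr_ge0// divr_ge0// mulr_ge0.
have [dd|dd] := eqVneq delta 0.
  move: D_le; rewrite dd mul0r => /le_trans; apply.
  rewrite mulr_ge0 ?exprn_ge0// mulr_ge0// exprn_ge0// divr_ge0//.
  exact: mulr_ge0.
have {dd}d_gt0 : 0 < delta by rewrite lt_def dd.
have DrV : Delta <= r + V.
  rewrite -(ler_pM2r d_gt0); apply: (le_trans (le_trans De_le D_le)).
  by nra.
have VD : s * Delta <= (alpha + s) * V by nra.
have rV : r <= alpha / s * V.
  by rewrite mulrAC ler_pdivlMr//; nra.
have D1 : D <= (1 + alpha / (4 * s)) * V.
  apply: (le_trans (regret_le_bias d01 r0 V0 D_le)).
  have -> : (1 + alpha / (4 * s)) * V = V + alpha / s * V / 4.
    by field; rewrite gt_eqF.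
  lra.
have K1 : 1 <= (alpha + s) / (s * Delta) * V.
  by rewrite mulrAC ler_pdivlMr ?mulr_gt0// mul1r.
have /= K3 := exprn_ege1 3 K1; rewrite exprMn in K3.
apply: (le_trans D1).
rewrite [leRHS](_ : _ = (1 + alpha / (4 * s)) * V *
  (((alpha + s) / (s * Delta)) ^+ 3 * V ^+ 3)); last by ring.
by rewrite ler_peMr// mulr_ge0.
Qed.

End regret_of_projection.

(** * Independence and integrals of products *)

Section independence.
Local Open Scope ereal_scope.
Context d0 (T : measurableType d0) (R : realType) (P : probability T R).

(** Independence of an event from the pair (Y, Z) only has to be checked on
    rectangles, which form a pi-system generating the product sigma-algebra. *)
Lemma independent_event_pair d1 d2 (T1 : measurableType d1)
    (T2 : measurableType d2) (Y : T -> T1) (Z : T -> T2) (E : set T) :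
  measurable_fun setT Y -> measurable_fun setT Z -> measurable E ->
  (forall B C, measurable B -> measurable C ->
    P (Y @^-1` B `&` Z @^-1` C `&` E) = P E * P (Y @^-1` B `&` Z @^-1` C)) ->
  forall D : set (T1 * T2), measurable D ->
  P ((fun w => (Y w, Z w)) @^-1` D `&` E) =
    P E * P ((fun w => (Y w, Z w)) @^-1` D).
Proof.
move=> mY mZ mE EYZ D mD.
pose h w := (Y w, Z w).
have mh : measurable_fun setT h by exact: measurable_fun_pair.
have E_fin : P E \is a fin_num by exact: fin_num_measure.
pose r : {nonneg R} := NngNum (fine_ge0 (measure_ge0 P E)).
pose m1 : {measure set (T1 * T2) -> \bar R} :=
  measure_function_pushforward__canonical__measure_function_Measure
    (mrestr P mE) mh.
pose m2 : {measure set (T1 * T2) -> \bar R} :=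
  mscale r (measure_function_pushforward__canonical__measure_function_Measure
    P mh).
have m2E A : m2 A = P E * P (h @^-1` A).
  by rewrite /m2/= /mscale/= fineK.
have -> : P (h @^-1` D `&` E) = m1 D by [].
rewrite -m2E.
apply: (measure_unique [set A `*` B | A in measurable & B in measurable]
  (fun=> setT)) => //.
- exact: measurable_prod_measurableType.
- move=> _ _ [X1 mX1 [X2 mX2 <-]] [Y1 mY1 [Y2 mY2 <-]].
  exists (X1 `&` Y1); first exact: measurableI.
  by exists (X2 `&` Y2); [exact: measurableI|rewrite setXI].
- by move=> _; exists setT => //; exists setT => //; rewrite setXTT.
- by rewrite bigcup_const.
- by move=> _ [B mB [C mC <-]]; rewrite m2E; exact: EYZ.
- move=> _; rewrite /m1/= /pushforward /mrestr preimage_setT setTI.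
  by rewrite -ge0_fin_numE.
Qed.

(** The law of (Y, Z) is the product of the laws of Y and Z, so that Fubini's
    theorem applies; boundedness is only asked along Y and Z because f and g
    will be polynomials in the coordinates. *)
Lemma Rintegral_independent d1 d2 (T1 : measurableType d1)
    (T2 : measurableType d2) (Y : T -> T1) (Z : T -> T2)
    (f : T1 -> R) (g : T2 -> R) (M : R) :
  measurable_fun setT Y -> measurable_fun setT Z ->
  (forall B C, measurable B -> measurable C ->
    P (Y @^-1` B `&` Z @^-1` C) = P (Y @^-1` B) * P (Z @^-1` C)) ->
  measurable_fun setT f -> measurable_fun setT g ->
  (forall w, (`|f (Y w)| <= M)%R) -> (forall w, (`|g (Z w)| <= M)%R) ->
  (\int[P]_w (f (Y w) * g (Z w)) =
    \int[P]_w f (Y w) * \int[P]_w g (Z w))%R.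
Proof.
move=> mY mZ YZ mf mg fM gM.
have bint (h : T -> R) (K : R) : measurable_fun setT h ->
    (forall w, (`|h w| <= K)%R) ->
    P.-integrable setT (EFin \o h).
  move=> mh hK; apply: measurable_bounded_integrable => //.
    by rewrite -ge0_fin_numE // fin_num_measure.
  exists K; split; first exact: num_real.
  by move=> x Kx w _; apply: (le_trans (hK w)); exact: ltW.
have mfY : measurable_fun setT (f \o Y) by exact: measurableT_comp.
have mgZ : measurable_fun setT (g \o Z) by exact: measurableT_comp.
have intf := bint _ _ mfY fM; have intg := bint _ _ mgZ gM.
pose Y' : {mfun T >-> T1} := HB.pack Y (isMeasurableFun.Build _ _ _ _ Y mY).
pose Z' : {mfun T >-> T2} := HB.pack Z (isMeasurableFun.Build _ _ _ _ Z mZ).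
pose h w := (Y w, Z w).
have mh : measurable_fun setT h by exact: measurable_fun_pair.
pose H' : {mfun T >-> (T1 * T2)%type} :=
  HB.pack h (isMeasurableFun.Build _ _ _ _ h mh).
pose k (p : T1 * T2) : \bar R := (f p.1 * g p.2)%R%:E.
have mk : measurable_fun setT k.
  by apply/measurable_EFinP; apply: measurable_funM; exact: measurableT_comp.
have EY : \int[distribution P Y']_y (f y)%:E = \int[P]_w (f (Y w))%:E.
  by rewrite integral_distribution//; exact/measurable_EFinP.
have EZ : \int[distribution P Z']_z (g z)%:E = \int[P]_w (g (Z w))%:E.
  by rewrite integral_distribution//; exact/measurable_EFinP.
have intY : (distribution P Y').-integrable setT (EFin \o f).
  by apply: integrable_pushforward => //; exact/measurable_EFinP.
have intZ : (distribution P Z').-integrable setT (EFin \o g).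
  by apply: integrable_pushforward => //; exact/measurable_EFinP.
have intk : (distribution P Y' \x distribution P Z').-integrable setT k.
  apply/integrable12ltyP => //.
  under eq_integral => y _.
    under eq_integral do rewrite /k/= normrM EFinM.
    rewrite ge0_integralZl//; last first.
      by apply/measurable_EFinP; exact: measurableT_comp.
    over.
  rewrite ge0_integralZr//; last 2 first.
    by apply/measurable_EFinP; exact: measurableT_comp.
    by apply: integral_ge0.
  move/integrableP: intY => [_ /= intY]; move/integrableP: intZ => [_ /= intZ].
  by rewrite lte_mul_pinfty// ?integral_ge0// ge0_fin_numE// integral_ge0.
have fin_g : \int[P]_w (g (Z w))%:E \is a fin_num.
  exact: (integrable_fin_num measurableT intg).
rewrite /Rintegral -fineM//; last exact: (integrable_fin_num measurableT intf).
congr fine.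
transitivity (\int[distribution P H']_p k p).
  rewrite integral_distribution//.
  apply: (bint (fun w => f (Y w) * g (Z w))%R (M * M)%R).
    by apply: measurable_funM.
  by move=> w; rewrite normrM ler_pM.
transitivity (\int[distribution P Y' \x distribution P Z']_p k p).
  apply/esym/eq_measure_integral => A mA _.
  by apply: product_measure_unique => // B C mB mC; exact: YZ.
rewrite -integral12_prod_meas1// -(fineK fin_g).
transitivity (\int[distribution P Y']_y
    ((f y)%:E * (fine (\int[P]_w (g (Z w))%:E))%:E)).
  apply: eq_integral => y _; rewrite fineK// -EZ -integralZl//.
by rewrite integralZr// EY.
Qed.

End independence.

(** * Borel measurability in coordinates *)

Section measurable_rV.
Context d0 (T : measurableType d0) (R : realType) (d : nat).

Lemma measurable_coord (j : 'I_d) :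
  measurable_fun setT (fun v : 'rV[R]_d => v 0 j).
Proof.
move=> _ Y mY; rewrite setTI; apply: sub_sigma_algebra => /=.
rewrite -bigcup_seq/=; exists j => /=; first by rewrite mem_index_enum.
by exists Y => //; rewrite setTI.
Qed.

Lemma measurable_rVP (f : T -> 'rV[R]_d) :
  (forall j, measurable_fun setT (fun w => f w 0 j)) -> measurable_fun setT f.
Proof.
move=> mf _ Y mY; rewrite setTI.
pose C := [set A : set 'rV[R]_d | measurable (f @^-1` A)].
suff : (measurable : set (set 'rV[R]_d)) `<=` C by apply.
apply: smallest_sub.
  split => [|A CA|F CF].
  - by rewrite /C/= preimage_set0; exact: measurable0.
  - by rewrite /C/= setTD preimage_setC; exact: measurableC.
  - by rewrite /C/= preimage_bigcup; exact: bigcupT_measurable.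
rewrite -bigcup_seq => A [j _ [B mB <-]].
by rewrite /C/= setTI -[X in measurable X]setTI; exact: (mf j).
Qed.

Lemma measurable_coord_comp (f : T -> 'rV[R]_d) j :
  measurable_fun setT f -> measurable_fun setT (fun w => f w 0 j).
Proof. by move=> mf; apply: (measurableT_comp (measurable_coord j)). Qed.

Lemma measurable_addrV (f g : T -> 'rV[R]_d) :
  measurable_fun setT f -> measurable_fun setT g ->
  measurable_fun setT (fun w => f w + g w).
Proof.
move=> mf mg; apply: measurable_rVP => j.
rewrite (_ : (fun w => _) = (fun w => f w 0 j + g w 0 j)).
  by apply: measurable_funD; exact: measurable_coord_comp.
by apply/funext => w; rewrite mxE.
Qed.

Lemma measurable_dotp (f g : T -> 'rV[R]_d) :
  measurable_fun setT f -> measurable_fun setT g ->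
  measurable_fun setT (fun w => dotp (f w) (g w)).
Proof.
move=> mf mg; apply: measurable_sum => j.
by apply: measurable_funM; exact: measurable_coord_comp.
Qed.

End measurable_rV.

(** * Partial sums of independent vectors *)

Section sums_of_independent_vectors.
Context d0 (T : measurableType d0) (R : realType) (P : probability T R).
Context (d : nat) (X : nat -> T -> 'rV[R]_d).
Hypothesis mX : forall i, measurable_fun setT (X i).
Hypothesis indX : forall (J : {fset nat}) (B : nat -> set 'rV[R]_d),
  (forall i, measurable (B i)) ->
  (P (\bigcap_(i in [set` J]) (X i @^-1` B i)) =
    \prod_(i <- J) P (X i @^-1` B i))%E.

Let G n w := \sum_(i < n) X i w.

Lemma measurable_sum_rV n : measurable_fun setT (G n).
Proof.
elim: n => [|n IH].
  rewrite (_ : G 0 = cst 0); first exact: measurable_cst.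
  by apply/funext => w; rewrite /G big_ord0.
rewrite (_ : G n.+1 = fun w => G n w + X n w); first exact: measurable_addrV.
by apply/funext => w; rewrite /G big_ord_recr.
Qed.

Let measurable_bigcapX (J : {fset nat}) (B : nat -> set 'rV[R]_d) :
  (forall i, measurable (B i)) ->
  measurable (\bigcap_(i in [set` J]) (X i @^-1` B i)).
Proof.
move=> mB; rewrite bigcap_fset; apply: bigsetI_measurable => i _.
by rewrite -[X in measurable X]setTI; exact: mX.
Qed.

(** The induction needs independence of G n from whole families of later
    vectors: G n.+1 is a function of the pair (G n, X n), and this pair is
    independent of the vectors after n because, on a rectangle, the event about
    X n can be counted among the later events to which the induction hypothesis
    applies. *)
Lemma sum_independent_of_later n (J : {fset nat}) (B0 : set 'rV[R]_d)
    (B : nat -> set 'rV[R]_d) :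
  (forall i, i \in J -> (n <= i)%N) -> measurable B0 ->
  (forall i, measurable (B i)) ->
  (P (G n @^-1` B0 `&` \bigcap_(i in [set` J]) (X i @^-1` B i)) =
   P (G n @^-1` B0) * P (\bigcap_(i in [set` J]) (X i @^-1` B i)))%E.
Proof.
elim: n J B0 B => [|n IH] J B0 B nJ mB0 mB.
  have -> : G 0 = cst 0 by apply/funext => w; rewrite /G big_ord0.
  rewrite preimage_cst; case: ifPn => _.
    by rewrite setTI probability_setT mul1e.
  by rewrite set0I measure0 mul0e.
set E := \bigcap_(i in _) _.
have mE : measurable E by exact: measurable_bigcapX.
pose D := (fun p : 'rV[R]_d * 'rV[R]_d => p.1 + p.2) @^-1` B0.
have -> : G n.+1 @^-1` B0 = (fun w => (G n w, X n w)) @^-1` D.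
  by apply/seteqP; split => w; rewrite /D /preimage/= /G big_ord_recr.
have mD : measurable D.
  by rewrite -[X in measurable X]setTI; apply: measurable_addrV.
rewrite [RHS]muleC.
have mG := measurable_sum_rV n.
apply: independent_event_pair => //.
move=> B1 C mB1 mC.
have n_nJ : n \notin J by apply/negP => /nJ; rewrite ltnn.
pose F (K : {fset nat}) := \bigcap_(i in [set` K]) (X i @^-1` B i).
have capn (K : {fset nat}) : n \notin K -> X n @^-1` C `&` F K =
    \bigcap_(i in [set` (n |` K)%fset])
      (X i @^-1` (if i == n then C else B i)).
  move=> nK; rewrite /F !bigcap_fset big_fsetU1//= eqxx; congr (_ `&` _).
  by apply: eq_big_seq => i iK; case: eqVneq => // ii; rewrite -ii iK in nK.
have mB' i : measurable (if i == n then C else B i) by case: ifP.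
have IHn (K : {fset nat}) : n \notin K -> (forall i, i \in K -> (n <= i)%N) ->
    (P (G n @^-1` B1 `&` (X n @^-1` C `&` F K)) =
     P (G n @^-1` B1) * (P (X n @^-1` C) * P (F K)))%E.
  move=> nK K_ge; rewrite (capn _ nK) IH//; last first.
    by move=> i /fset1UP[->|/K_ge].
  congr (_ * _)%E; rewrite /F indX// indX// big_fsetU1//= eqxx; congr (_ * _)%E.
  by apply: eq_big_seq => i iK; case: eqVneq => // ii; rewrite -ii iK in nK.
rewrite -setIA -/(F J) IHn//; last by move=> i /nJ/ltnW.
have := IHn fset0; rewrite /F set_fset0 bigcap_set0 setIT.
rewrite probability_setT mule1.
by move=> ->//; rewrite muleA [LHS]muleC.
Qed.

Lemma sum_independent_of_next n (B C : set 'rV[R]_d) :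
  measurable B -> measurable C ->
  (P (G n @^-1` B `&` X n @^-1` C) = P (G n @^-1` B) * P (X n @^-1` C))%E.
Proof.
move=> mB mC.
have := @sum_independent_of_later n [fset n]%fset B (fun=> C) _ mB (fun=> mC).
by rewrite !bigcap_fset big_seq_fset1; apply => i /fset1P ->.
Qed.

End sums_of_independent_vectors.

(** * Bounded random variables *)

Section bounded_random_variables.
Context d0 (T : measurableType d0) (R : realType) (P : probability T R).
Implicit Types f g : T -> R.

(** Surely, and not only almost surely, bounded: these functions are closed
    under the operations below and integrable, so that expectations of
    polynomials can be expanded without side conditions. *)
Definition bounded_rv f :=
  measurable_fun setT f /\ exists M : R, forall w, `|f w| <= M.

Lemma bounded_rv_integrable f : bounded_rv f -> P.-integrable setT (EFin \o f).
Proof.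
move=> [mf [M fM]]; apply: measurable_bounded_integrable => //.
  by rewrite -ge0_fin_numE // fin_num_measure.
exists M; split; first exact: num_real.
by move=> x Mx w _; apply: (le_trans (fM w)); exact: ltW.
Qed.

Lemma bounded_rv_cst (k : R) : bounded_rv (cst k).
Proof. by split; [exact: measurable_cst|exists `|k|]. Qed.

Lemma bounded_rvD f g : bounded_rv f -> bounded_rv g ->
  bounded_rv (fun w => f w + g w).
Proof.
move=> [mf [M fM]] [mg [N gN]]; split; first exact: measurable_funD.
by exists (M + N) => w; rewrite (le_trans (ler_normD _ _))// lerD.
Qed.

Lemma bounded_rvM f g : bounded_rv f -> bounded_rv g ->
  bounded_rv (fun w => f w * g w).
Proof.
move=> [mf [M fM]] [mg [N gN]]; split; first exact: measurable_funM.
by exists (M * N) => w; rewrite normrM ler_pM.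
Qed.

Lemma bounded_rvZ (k : R) f : bounded_rv f -> bounded_rv (fun w => k * f w).
Proof. by move=> bf; apply: bounded_rvM => //; exact: bounded_rv_cst. Qed.

Lemma bounded_rvX f n : bounded_rv f -> bounded_rv (fun w => f w ^+ n).
Proof.
move=> [mf [M fM]]; split; first exact: measurable_funX.
by exists (M ^+ n) => w; rewrite normrX lerXn2r// nnegrE (le_trans _ (fM w)).
Qed.

Lemma bounded_rv_sum (I : Type) (s : seq I) (f : I -> T -> R) :
  (forall i, bounded_rv (f i)) -> bounded_rv (fun w => \sum_(i <- s) f i w).
Proof.
move=> bf; elim: s => [|i s IH].
  by under eq_fun do rewrite big_nil; exact: bounded_rv_cst.
by under eq_fun do rewrite big_cons; exact: bounded_rvD.
Qed.

Lemma Rintegral_bounded_rv_sum (I : Type) (s : seq I) (f : I -> T -> R) :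
  (forall i, bounded_rv (f i)) ->
  \int[P]_w (\sum_(i <- s) f i w) = \sum_(i <- s) \int[P]_w f i w.
Proof.
move=> bf; elim: s => [|i s IH].
  under eq_Rintegral do rewrite big_nil.
  by rewrite big_nil Rintegral_cst// mul0r.
under eq_Rintegral do rewrite big_cons.
rewrite big_cons RintegralD// ?IH//; apply: bounded_rv_integrable => //.
exact: bounded_rv_sum.
Qed.

Lemma Rintegral_bounded_rvD f g : bounded_rv f -> bounded_rv g ->
  \int[P]_w (f w + g w) = \int[P]_w f w + \int[P]_w g w.
Proof.
by move=> bf bg; apply: RintegralD => //; exact: bounded_rv_integrable.
Qed.

Lemma Rintegral_bounded_rvZ (k : R) f : bounded_rv f ->
  \int[P]_w (k * f w) = k * \int[P]_w f w.
Proof.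
by move=> bf; apply: RintegralZl => //; exact: bounded_rv_integrable.
Qed.

Lemma le_Rintegral_bounded_rv f g : bounded_rv f -> bounded_rv g ->
  (forall w, f w <= g w) -> \int[P]_w f w <= \int[P]_w g w.
Proof.
by move=> bf bg fg; apply: le_Rintegral => //; exact: bounded_rv_integrable.
Qed.

Lemma Rintegral_prob_cst (k : R) : \int[P]_w k = k.
Proof. by rewrite Rintegral_cst//= probability_setT mulr1. Qed.

End bounded_random_variables.

(** * Second and fourth moments of partial sums *)

Section moments_of_sums.
Context d0 (T : measurableType d0) (R : realType) (P : probability T R).
Context (d : nat) (X : nat -> T -> 'rV[R]_d).
Hypothesis mX : forall i, measurable_fun setT (X i).
Hypothesis indX : forall (J : {fset nat}) (B : nat -> set 'rV[R]_d),
  (forall i, measurable (B i)) ->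
  (P (\bigcap_(i in [set` J]) (X i @^-1` B i)) =
    \prod_(i <- J) P (X i @^-1` B i))%E.
Hypothesis bX : forall i j, bounded_rv (fun w => X i w 0 j).
Hypothesis X_centered : forall i j, \int[P]_w X i w 0 j = 0.
Variable sigma : R.
Hypothesis X_second : forall i, \int[P]_w dotp (X i w) (X i w) <= sigma.
Hypothesis X_fourth : forall i,
  \int[P]_w (dotp (X i w) (X i w) ^+ 2) <= 3 * sigma ^+ 2.

Let G n w := \sum_(i < n) X i w.
Let Q n w := dotp (G n w) (G n w).
Let q n w := dotp (X n w) (X n w).

Let GS n w : G n.+1 w = G n w + X n w.
Proof. by rewrite /G big_ord_recr. Qed.

Let QS n w : Q n.+1 w = Q n w + q n w + 2 * dotp (G n w) (X n w).
Proof. by rewrite /Q /q GS dotpDl !dotpDr (dotpC (X n w) (G n w)); ring. Qed.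

Let bG n j : bounded_rv (fun w => G n w 0 j).
Proof.
rewrite (_ : (fun w => _) = fun w => \sum_(i < n) X i w 0 j).
  exact: bounded_rv_sum.
by apply/funext => w; rewrite summxE.
Qed.

Let bQ n : bounded_rv (Q n).
Proof. by apply: bounded_rv_sum => j; exact: bounded_rvM. Qed.

Let bq n : bounded_rv (q n).
Proof. by apply: bounded_rv_sum => j; exact: bounded_rvM. Qed.

Let G_centered n j : \int[P]_w G n w 0 j = 0.
Proof.
under eq_Rintegral do rewrite summxE.
by rewrite Rintegral_bounded_rv_sum// big1.
Qed.

Let indep n (f g : 'rV[R]_d -> R) :
  measurable_fun setT f -> measurable_fun setT g ->
  bounded_rv (fun w => f (G n w)) -> bounded_rv (fun w => g (X n w)) ->
  \int[P]_w (f (G n w) * g (X n w)) =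
  \int[P]_w f (G n w) * \int[P]_w g (X n w).
Proof.
move=> mf mg [_ [M fM]] [_ [N gN]].
apply: (@Rintegral_independent _ _ _ _ _ _ _ _ _ _ _ _ (Num.max M N)) => //.
- exact: measurable_sum_rV.
- exact: sum_independent_of_next.
- by move=> w; rewrite le_max fM.
- by move=> w; rewrite le_max gN orbT.
Qed.

Let mcoord := @measurable_coord R d.
Let msq : measurable_fun setT (fun v : 'rV[R]_d => dotp v v).
Proof. exact: measurable_dotp. Qed.

Lemma second_moment_sum n : \int[P]_w Q n w <= n%:R * sigma.
Proof.
elim: n => [|n IH].
  rewrite mul0r; under eq_Rintegral => w _.
    rewrite /Q /G big_ord0 /dotp big1; last by move=> j _; rewrite mxE mul0r.
    over.
  by rewrite Rintegral_prob_cst.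
have -> : \int[P]_w Q n.+1 w =
    \int[P]_w ((Q n w + q n w) + 2 * \sum_(j < d) G n w 0 j * X n w 0 j).
  by apply: eq_Rintegral => w _; rewrite QS.
have bGX j : bounded_rv (fun w => G n w 0 j * X n w 0 j) by exact: bounded_rvM.
rewrite Rintegral_bounded_rvD; [|exact: bounded_rvD|]; last first.
  by apply: bounded_rvZ; exact: bounded_rv_sum.
rewrite Rintegral_bounded_rvZ; last exact: bounded_rv_sum.
rewrite Rintegral_bounded_rvD// (Rintegral_bounded_rv_sum _ _ bGX) big1;
  last first.
  move=> j _; rewrite (indep (f := fun v => v 0 j) (g := fun v => v 0 j))//.
  by rewrite X_centered mulr0.
rewrite mulr0 addr0 -[n.+1]addn1 natrD mulrDl mul1r.
by apply: lerD; [exact: IH|exact: X_second].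
Qed.

(** With G the current sum, x the next vector, Q = |G|^2 and q = |x|^2, expand
    (Q + q + 2 <G, x>)^2 and bound 4 <G, x>^2 by 4 Q q.  The terms that remain
    beside Q^2 + q^2 + 6 Q q are 4 Q <G, x>, whose mean vanishes since x is
    centered and independent of G, and 4 q <G, x>, whose mean vanishes since G
    is centered.  Hence the bound grows by
    (6 n + 3) sigma^2 = 3 ((n + 1)^2 - n^2) sigma^2. *)
Lemma fourth_moment_sum n :
  \int[P]_w (Q n w ^+ 2) <= 3 * (n%:R * sigma) ^+ 2.
Proof.
elim: n => [|n IH].
  rewrite mul0r expr0n mulr0; under eq_Rintegral => w _.
    rewrite /Q /G big_ord0 /dotp big1; last by move=> j _; rewrite mxE mul0r.
    rewrite expr0n/=.
    over.
  by rewrite Rintegral_prob_cst.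
have bQG j : bounded_rv (fun w => Q n w * G n w 0 j) by exact: bounded_rvM.
have bXq j : bounded_rv (fun w => X n w 0 j * q n w) by exact: bounded_rvM.
have bl : bounded_rv (fun w => (Q n w ^+ 2 + q n w ^+ 2) + 6 * (Q n w * q n w)).
  apply: bounded_rvD; last by apply: bounded_rvZ; exact: bounded_rvM.
  by apply: bounded_rvD; exact: bounded_rvX.
have bs1 j : bounded_rv (fun w => (Q n w * G n w 0 j) * X n w 0 j).
  exact: bounded_rvM.
have bs2 j : bounded_rv (fun w => G n w 0 j * (X n w 0 j * q n w)).
  exact: bounded_rvM.
have bs : bounded_rv (fun w => 4 * \sum_(j < d) (Q n w * G n w 0 j) * X n w 0 j
   + 4 * \sum_(j < d) G n w 0 j * (X n w 0 j * q n w)).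
  by apply: bounded_rvD; apply: bounded_rvZ; exact: bounded_rv_sum.
apply: (@le_trans _ _ (\int[P]_w (((Q n w ^+ 2 + q n w ^+ 2)
    + 6 * (Q n w * q n w))
   + (4 * \sum_(j < d) (Q n w * G n w 0 j) * X n w 0 j
      + 4 * \sum_(j < d) G n w 0 j * (X n w 0 j * q n w))))).
  apply: le_Rintegral_bounded_rv; [exact: bounded_rvX|exact: bounded_rvD|].
  move=> w.
  have -> : \sum_(j < d) (Q n w * G n w 0 j) * X n w 0 j =
      Q n w * dotp (G n w) (X n w).
    by rewrite /dotp mulr_sumr; apply: eq_bigr => j _; rewrite mulrA.
  have -> : \sum_(j < d) G n w 0 j * (X n w 0 j * q n w) =
      dotp (G n w) (X n w) * q n w.
    by rewrite /dotp mulr_suml; apply: eq_bigr => j _; rewrite mulrA.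
  have : dotp (G n w) (X n w) ^+ 2 <= Q n w * q n w.
    rewrite /Q /q -!sqr_enorm -exprMn -[leLHS]real_normK ?num_real//.
    by rewrite ler_sqr ?nnegrE ?normr_ge0 ?mulr_ge0 ?enorm_ge0 ?cauchy_schwarz.
  rewrite QS.
  by move: (dotp (G n w) (X n w)) (Q n w) (q n w) => t u v; nra.
rewrite Rintegral_bounded_rvD// Rintegral_bounded_rvD; last 2 first.
  by apply: bounded_rvD; exact: bounded_rvX.
  by apply: bounded_rvZ; exact: bounded_rvM.
rewrite Rintegral_bounded_rvD; [|exact: bounded_rvX|exact: bounded_rvX].
rewrite Rintegral_bounded_rvZ; last exact: bounded_rvM.
rewrite Rintegral_bounded_rvD; last 2 first.
  by apply: bounded_rvZ; exact: bounded_rv_sum.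
  by apply: bounded_rvZ; exact: bounded_rv_sum.
rewrite !Rintegral_bounded_rvZ; [|exact: bounded_rv_sum|exact: bounded_rv_sum].
rewrite (Rintegral_bounded_rv_sum _ _ bs1) (Rintegral_bounded_rv_sum _ _ bs2).
rewrite [X in 4 * X + _]big1; last first.
  move=> j _.
  rewrite (indep (f := fun v => dotp v v * v 0 j) (g := fun v => v 0 j))//.
    by rewrite X_centered mulr0.
  exact: measurable_funM.
rewrite [X in 4 * 0 + 4 * X]big1; last first.
  move=> j _.
  rewrite (indep (f := fun v => v 0 j) (g := fun v => v 0 j * dotp v v))//.
    by rewrite G_centered mul0r.
  exact: measurable_funM.
rewrite (indep (f := fun v => dotp v v) (g := fun v => dotp v v))//;
  [|exact: bQ|exact: bq].
have Q0 : 0 <= \int[P]_w Q n w by apply: Rintegral_ge0 => w _; exact: dotp_ge0.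
have q0 : 0 <= \int[P]_w q n w by apply: Rintegral_ge0 => w _; exact: dotp_ge0.
have := ler_pM Q0 q0 (second_moment_sum n) (X_second n).
have := X_fourth n; move: IH; rewrite -[n.+1]addn1 natrD.
rewrite -/(q n) -/(Q n).
lra.
Qed.

End moments_of_sums.

(** * Moments of a centered bounded vector *)

Section centered_bounded_vector.
Context d0 (T : measurableType d0) (R : realType) (P : probability T R).
Context (d : nat) (B : T -> 'rV[R]_d) (a : 'rV[R]_d) (L r : R).
Hypothesis mB : measurable_fun setT B.
Hypothesis L_gt0 : 0 < L.
Hypothesis r_gt0 : 0 < r.
Hypothesis BL : forall w, enorm (B w) <= L.
Hypothesis Br : forall w, enorm (B w - a) <= r.
Hypothesis B_mean : forall j, \int[P]_w B w 0 j = a 0 j.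

Let bB j : bounded_rv (fun w => B w 0 j).
Proof.
split; first exact: measurable_coord_comp.
by exists L => w; rewrite (le_trans (normr_coord_le_enorm _ _)).
Qed.

Let bsq : bounded_rv (fun w => dotp (B w - a) (B w - a)).
Proof.
apply: bounded_rv_sum => j; apply: bounded_rvM;
  under eq_fun do rewrite mxE [X in _ + X]mxE;
  by apply: bounded_rvD => //; exact: bounded_rv_cst.
Qed.

Let E_dotp (v : 'rV[R]_d) : \int[P]_w dotp v (B w) = dotp v a.
Proof.
rewrite Rintegral_bounded_rv_sum; last by move=> j; exact: bounded_rvZ.
by apply: eq_bigr => j _; rewrite Rintegral_bounded_rvZ// B_mean.
Qed.

Let b_dotp (v : 'rV[R]_d) : bounded_rv (fun w => dotp v (B w)).
Proof. by apply: bounded_rv_sum => j; exact: bounded_rvZ. Qed.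

Lemma enorm_mean_le : enorm a <= L.
Proof.
have [a0|a0] := eqVneq (enorm a) 0; first by rewrite a0 ltW.
have a_gt0 : 0 < enorm a by rewrite lt_def a0 enorm_ge0.
rewrite -(ler_pM2l a_gt0) -expr2 sqr_enorm -E_dotp.
rewrite -[leRHS](Rintegral_prob_cst P).
apply: le_Rintegral_bounded_rv => //; first exact: bounded_rv_cst.
move=> w; apply: le_trans (ler_norm _) _.
apply: le_trans (cauchy_schwarz _ _) _.
by rewrite ler_wpM2l// enorm_ge0.
Qed.

Let sqE w : dotp (B w - a) (B w - a) =
  dotp (B w) (B w) + (-2 * dotp a (B w) + dotp a a).
Proof. by rewrite dotpDl !dotpDr !(dotpNl, dotpNr) (dotpC (B w) a); ring. Qed.

Lemma second_moment_le_variance :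
  \int[P]_w dotp (B w - a) (B w - a) <= L ^+ 2 - dotp a a.
Proof.
have -> : L ^+ 2 - dotp a a =
    \int[P]_w (L ^+ 2 + (-2 * dotp a (B w) + dotp a a)).
  rewrite Rintegral_bounded_rvD; [|exact: bounded_rv_cst|]; last first.
    by apply: bounded_rvD; [exact: bounded_rvZ|exact: bounded_rv_cst].
  rewrite Rintegral_bounded_rvD; [|exact: bounded_rvZ|exact: bounded_rv_cst].
  rewrite (Rintegral_bounded_rvZ P (-2) (b_dotp a)) E_dotp.
  by rewrite !Rintegral_prob_cst; ring.
apply: le_Rintegral_bounded_rv => //.
  apply: bounded_rvD; first exact: bounded_rv_cst.
  by apply: bounded_rvD; [exact: bounded_rvZ|exact: bounded_rv_cst].
move=> w; rewrite sqE lerD2r -sqr_enorm.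
by rewrite ler_sqr ?nnegrE ?enorm_ge0// ltW.
Qed.

(** Both bounds matter: centering does not increase the second moment, so that
    the noise is also controlled by the bound L on the costs themselves. *)
Lemma second_moment_centered :
  \int[P]_w dotp (B w - a) (B w - a) <= Num.min L r ^+ 2.
Proof.
case: (leP L r) => _.
  apply: le_trans second_moment_le_variance _.
  by rewrite gerBl dotp_ge0.
rewrite -[leRHS](Rintegral_prob_cst P).
apply: le_Rintegral_bounded_rv => //; first exact: bounded_rv_cst.
by move=> w; rewrite -sqr_enorm ler_sqr ?nnegrE ?enorm_ge0// ltW.
Qed.

(** If the minimum is L, a plain bound by the diameter would give the factor 4,
    which is too much for the induction in [fourth_moment_sum].  Instead, with
    m = |a|, the squared norm is at most (L + m)^2 and has mean at most
    L^2 - m^2, and (L + m)^2 (L^2 - m^2) <= 3 L^4. *)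
Lemma fourth_moment_centered :
  \int[P]_w (dotp (B w - a) (B w - a) ^+ 2) <= 3 * (Num.min L r ^+ 2) ^+ 2.
Proof.
case: (leP L r) => _; last first.
  rewrite -[leRHS](Rintegral_prob_cst P).
  apply: le_Rintegral_bounded_rv => //;
    [exact: bounded_rvX|exact: bounded_rv_cst|].
  move=> w; rewrite -sqr_enorm.
  have : enorm (B w - a) ^+ 2 <= r ^+ 2.
    by rewrite ler_sqr ?nnegrE ?enorm_ge0// ltW.
  have := sqr_ge0 (enorm (B w - a)); nra.
set m := enorm a; have m_ge0 : 0 <= m := enorm_ge0 a.
have mL : m <= L := enorm_mean_le.
apply: (@le_trans _ _ (\int[P]_w ((L + m) ^+ 2 * dotp (B w - a) (B w - a)))).
  apply: le_Rintegral_bounded_rv; [exact: bounded_rvX|exact: bounded_rvZ|].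
  move=> w; rewrite expr2 ler_wpM2r ?dotp_ge0//.
  rewrite sqE -2!sqr_enorm -/m.
  have : enorm (B w) ^+ 2 <= L ^+ 2.
    by rewrite ler_sqr ?nnegrE ?enorm_ge0// ltW.
  have : - dotp a (B w) <= m * L.
    apply: le_trans (ler_norm _) _; rewrite normrN.
    by apply: le_trans (cauchy_schwarz _ _) _; rewrite ler_wpM2l.
  nra.
rewrite Rintegral_bounded_rvZ//.
apply: le_trans (ler_wpM2l (sqr_ge0 _) second_moment_le_variance) _.
rewrite -sqr_enorm -/m.
have Lm : 0 <= L ^+ 3 * (L - m) by rewrite mulr_ge0 ?subr_ge0 ?exprn_ge0// ltW.
have Lm3 : 0 <= L * m ^+ 3 by rewrite mulr_ge0 ?exprn_ge0// ltW.
have m4 : 0 <= m ^+ 4 by rewrite exprn_ge0.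
lra.
Qed.

End centered_bounded_vector.

(** * From almost sure to sure bounds *)

Section truncation.
Context d0 (T : measurableType d0) (R : realType) (P : probability T R).
Context (d : nat) (A : nat -> {RV P >-> 'rV[R]_d}) (a : 'rV[R]_d) (L r : R).
Hypothesis L_gt0 : 0 < L.
Hypothesis r_gt0 : 0 < r.

(** Values outside the two balls are replaced by v0, a value actually taken at
    a point where all the bounds hold.  The replacement is a fixed measurable
    function of the vector, hence preserves independence. *)
Lemma bounded_modification : mutually_independent A ->
  (forall i j, ('E_P[fun w : T => (A i w 0 j)%R] = (a 0 j)%:E)%E) ->
  (forall i, \forall w \ae P, enorm (A i w) <= L) ->
  (forall i, \forall w \ae P, enorm (A i w - a) <= r) ->
  exists B : nat -> T -> 'rV[R]_d,
    [/\ [/\ forall i, measurable_fun setT (B i),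
      forall (J : {fset nat}) (C : nat -> set 'rV[R]_d),
        (forall i, measurable (C i)) ->
        (P (\bigcap_(i in [set` J]) (B i @^-1` C i)) =
        \prod_(i <- J) P (B i @^-1` C i))%E &
      forall i j, \int[P]_w B i w 0 j = a 0 j],
      forall i w, enorm (B i w) <= L,
      forall i w, enorm (B i w - a) <= r &
      \forall w \ae P, forall i, A i w = B i w].
Proof.
move=> indA meanA AL Ar.
have good : \forall w \ae P,
    forall i, enorm (A i w) <= L /\ enorm (A i w - a) <= r.
  by apply: ae_foralln => i; apply: filterS2 (AL i) (Ar i).
have [w0 w0P] : exists w,
    forall i, enorm (A i w) <= L /\ enorm (A i w - a) <= r.
  have PT : (0 < P setT)%E by rewrite /= probability_setT lte01.
  have PF := ae_properfilter_algebraOfSetsType PT.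
  exact: filter_ex good.
pose v0 := A 0%N w0.
pose ok v := (dotp v v <= L ^+ 2) && (dotp (v - a) (v - a) <= r ^+ 2).
have okP v : reflect (enorm v <= L /\ enorm (v - a) <= r) (ok v).
  rewrite /ok -!sqr_enorm.
  rewrite !ler_sqr ?nnegrE ?enorm_ge0 ?(ltW L_gt0) ?(ltW r_gt0)//.
  exact: andP.
pose h v := if ok v then v else v0.
have okh v : ok (h v).
  by rewrite /h; case: ifP => // _; apply/okP; exact: w0P.
have mid : measurable_fun setT (fun v : 'rV[R]_d => v) by exact: measurable_id.
have mok : measurable_fun setT ok.
  apply: measurable_and; apply: measurable_fun_ler => //.
    exact: measurable_dotp.
  by apply: measurable_dotp; apply: measurable_addrV.
have mh : measurable_fun setT h by apply: measurable_fun_ifT.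
have mA i : measurable_fun setT (A i) by exact: measurable_funPT.
have mB i : measurable_fun setT (h \o A i) by exact: measurableT_comp.
have AB : \forall w \ae P, forall i, A i w = h (A i w).
  by apply: filterS good => w wP i; rewrite /h; case: okP => // -[]; exact: wP.
exists (fun i => h \o A i); split => //.
- split => // [J C mC|i j].
    have mhC i : measurable (h @^-1` C i).
      by rewrite -[X in measurable X]setTI; exact: mh.
    by have := indA J (fun i => h @^-1` C i) mhC.
  transitivity (fine (\int[P]_w (A i w 0 j)%:E)%E); last first.
    by have := meanA i j; rewrite unlock => ->.
  congr fine; apply: ae_eq_integral => //.
  + by apply/measurable_EFinP; apply: measurable_coord_comp.
  + by apply/measurable_EFinP; apply: measurable_coord_comp.
  + by apply: filterS AB => w wP _ /=; rewrite -wP.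
- by move=> i w; have /okP[] := okh (A i w).
- by move=> i w; have /okP[] := okh (A i w).
Qed.

End truncation.

(** * A series controlled in two regimes *)

Section two_regimes.
Context (R : realType).

Lemma invsqrt_le_diff (p q : R) : 0 <= p -> 0 < q -> q ^+ 2 = p ^+ 2 + 1 ->
  q^-1 <= 2 * (q - p).
Proof.
move=> p0 q0 qp; rewrite -(ler_pM2l q0) divff ?gt_eqF//.
have := sqr_ge0 (q - p); nra.
Qed.

(** The right-hand side is the integral over x > 0 of the function equal to
    A / sqrt x before X and to B / x^2 after X.  Each term is at most the
    integral of this function over the unit interval that ends at its index, so
    that nothing is lost to rounding X to an integer, even if X is small. *)
Lemma sum_two_regimes (A B X : R) (e : nat -> R) : 0 <= A -> 0 <= B -> 0 < X ->
  (forall n, e n <= A / Num.sqrt n.+1%:R) ->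
  (forall n, X < n.+1%:R -> e n <= B / n.+1%:R ^+ 2) ->
  forall N, \sum_(i < N) e i <= 2 * A * Num.sqrt X + B / X.
Proof.
move=> A0 B0 X0 eA eB.
(* the integral of that function from 0 to N *)
pose H (N : nat) := if N%:R <= X then 2 * A * Num.sqrt N%:R
  else 2 * A * Num.sqrt X + B * (X^-1 - N%:R^-1).
have HX (N : nat) : H N <= 2 * A * Num.sqrt X + B / X.
  rewrite /H; case: ifP => [NX|_].
    rewrite ler_wpDr ?divr_ge0 ?(ltW X0)// ler_wpM2l ?mulr_ge0// ler_sqrt//.
    exact: ltW.
  by rewrite lerD2l ler_wpM2l// gerBl invr_ge0.
move=> N; apply: le_trans (HX N); elim: N => [|N IH].
  by rewrite big_ord0 /H mulr0n (ltW X0) sqrtr0 mulr0.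
rewrite big_ord_recr/=; apply: le_trans (lerD IH (lexx _)) _.
have n_gt0 : 0 < N.+1%:R :> R by rewrite ltr0n.
have Nn : N%:R + 1 = N.+1%:R :> R by rewrite -natr1.
have N_ge0 : 0 <= N%:R :> R by rewrite ler0n.
have eAN := eA N; have eBN := eB N.
rewrite -lerBrDl /H.
move: Nn n_gt0 eAN eBN; set n := N.+1%:R; set m := N%:R in N_ge0 *.
move=> Nn n_gt0 eAN eBN.
set p := Num.sqrt m; set q := Num.sqrt n.
have p_ge0 : 0 <= p by exact: sqrtr_ge0.
have q_gt0 : 0 < q by rewrite sqrtr_gt0.
have p2 : p ^+ 2 = m by rewrite sqr_sqrtr.
have q2 : q ^+ 2 = n by rewrite sqr_sqrtr// ltW.
have [nX|Xn] := leP n X.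
  have -> : m <= X by lra.
  apply: (le_trans eAN); rewrite -mulrBr [2 * A]mulrC -mulrA ler_wpM2l//.
  by apply: invsqrt_le_diff; rewrite // p2 q2 Nn.
have {}eBN := eBN Xn.
have [mX|Xm] := leP m X; last first.
  rewrite opprD addrACA subrr add0r -mulrBr.
  apply: (le_trans eBN); rewrite ler_wpM2l//.
  have m_gt0 : 0 < m by apply: lt_trans Xm.
  have -> : X^-1 - n^-1 - (X^-1 - m^-1) = (m * n)^-1.
    by rewrite -Nn; field; rewrite Nn !gt_eqF.
  by rewrite lef_pV2 ?posrE ?mulr_gt0 ?exprn_gt0// expr2 ler_wpM2r ?ltW//; lra.
(* here m = n - 1 <= X < n: split the term e N with the weights X - m and
   n - X, and use one of its two bounds for each part *)
set x := Num.sqrt X.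
have x_gt0 : 0 < x by rewrite sqrtr_gt0.
have x2 : x ^+ 2 = X by rewrite sqr_sqrtr// ltW.
have xq : x <= q by rewrite ler_wsqrtr ?ltW.
have px : p <= x by rewrite ler_wsqrtr.
have w1 : e N * (X - m) <= 2 * A * (x - p).
  apply: (@le_trans _ _ (A / q * (X - m))).
    by rewrite ler_wpM2r ?subr_ge0.
  rewrite [2 * A]mulrC -!mulrA ler_wpM2l// mulrC ler_pdivrMr//.
  by rewrite -x2 -p2; nra.
have w2 : e N * (n - X) <= B * (X^-1 - n^-1).
  apply: (@le_trans _ _ (B / n ^+ 2 * (n - X))).
    by rewrite ler_wpM2r// subr_ge0 ltW.
  have -> : X^-1 - n^-1 = (X * n)^-1 * (n - X).
    by field; rewrite !gt_eqF.
  rewrite -!mulrA ler_wpM2l// ler_wpM2r ?subr_ge0 ?(ltW Xn)//.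
  rewrite lef_pV2 ?posrE ?mulr_gt0 ?exprn_gt0// expr2 ler_wpM2r ?ltW//.
suff -> : e N = e N * (X - m) + e N * (n - X).
  by apply: (le_trans (lerD w1 w2)); rewrite mulrBr addrAC lexx.
by rewrite -mulrDr -Nn; ring.
Qed.

End two_regimes.

(** * Numerical inequalities *)

Section numeric.
Context (R : realType).

Lemma expRN2_ge : 10^-1 <= expR (- 2) :> R.
Proof.
have e4 : 3 / 4 <= expR (- (1 / 4)) :> R.
  by apply: le_trans (expR_ge1Dx _); lra.
have -> : (- 2 : R) = 8%:R * (- (1 / 4)) by field.
rewrite expRM_natl; apply: le_trans (lerXn2r 8 _ _ e4);
  rewrite ?nnegrE ?expR_ge0//.
lra.
Qed.

(** This inequality and [long_horizon_budget] compare the outcome of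
    [sum_two_regimes] with the claimed constant.  The left-hand side has the
    margin s = 2 rho, the right-hand side borrows from the exponential term E,
    which is not small when alpha <= 2 rho. *)
Lemma short_horizon_budget (alpha rho E : R) : 0 < rho -> 0 < alpha ->
  10^-1 <= E ->
  2 * (alpha / 4 + 17 / 12 * rho) * (alpha + 2 * rho) +
  12 * rho ^+ 4 * (1 + alpha / (4 * (2 * rho))) * (alpha + 2 * rho) /
    (2 * rho) ^+ 3 <=
  3 * alpha ^+ 2 + 6 * rho ^+ 2 + 72 * rho ^+ 2 * E.
Proof.
move=> r0 a0 E0.
have -> : 12 * rho ^+ 4 * (1 + alpha / (4 * (2 * rho))) * (alpha + 2 * rho) /
    (2 * rho) ^+ 3 = 3 / 2 * (rho + alpha / 8) * (alpha + 2 * rho).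
  by field; rewrite gt_eqF.
have : 72 * rho ^+ 2 * 10^-1 <= 72 * rho ^+ 2 * E.
  by apply: ler_wpM2l => //; have := sqr_ge0 rho; lra.
have := sqr_ge0 (alpha - 5 / 4 * rho); have := sqr_ge0 rho.
have := sqr_ge0 alpha.
nra.
Qed.

(** For alpha >= 2 rho the exponential term may be negligible and is not used;
    the sharper constant coming from [regret_le_square] and the margin
    s = 3 rho make up for it. *)
Lemma long_horizon_budget (alpha rho : R) : 0 < rho -> 2 * rho <= alpha ->
  2 * ((alpha + 17 / 12 * rho) ^+ 2 / (4 * alpha)) * (alpha + 3 * rho) +
  12 * rho ^+ 4 * (1 + alpha / (4 * (3 * rho))) * (alpha + 3 * rho) /
    (3 * rho) ^+ 3 <=
  3 * alpha ^+ 2 + 6 * rho ^+ 2.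
Proof.
move=> r0 ra; have a0 : 0 < alpha by lra.
have -> : 2 * ((alpha + 17 / 12 * rho) ^+ 2 / (4 * alpha)) * (alpha + 3 * rho) +
  12 * rho ^+ 4 * (1 + alpha / (4 * (3 * rho))) * (alpha + 3 * rho) /
    (3 * rho) ^+ 3 =
  ((alpha + 17 / 12 * rho) ^+ 2 * (alpha + 3 * rho) +
   8 / 9 * alpha * (rho + alpha / 12) * (alpha + 3 * rho)) / (2 * alpha).
  by field; rewrite !gt_eqF.
rewrite ler_pdivrMr ?mulr_gt0//.
(* in rho and t = alpha - 2 rho, the difference has nonnegative coefficients *)
have [t [t0 ->]] : exists t, 0 <= t /\ alpha = 2 * rho + t.
  by exists (alpha - 2 * rho); split; [lra|ring].
have := exprn_ge0 3 t0; have := exprn_ge0 3 (ltW r0).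
have := mulr_ge0 (exprn_ge0 2 t0) (ltW r0).
have := mulr_ge0 (exprn_ge0 2 (ltW r0)) t0.
lra.
Qed.

End numeric.

(** * Domination without measurability of the smaller function *)

Section domination.
Local Open Scope ereal_scope.
Context d0 (T : measurableType d0) (R : realType) (P : probability T R).

(** The integral of a nonnegative function is a supremum over simple functions
    below it, which is monotone even on nonmeasurable functions. *)
Lemma ge0_le_integral_nonmeasurable (f1 f2 : T -> \bar R) :
  (forall w, 0 <= f1 w) -> (forall w, f1 w <= f2 w) ->
  \int[P]_w f1 w <= \int[P]_w f2 w.
Proof.
move=> f10 f12; have f20 w : 0 <= f2 w by exact: le_trans (f12 w).
rewrite !ge0_integralTE//; apply: ereal_sup_le => _ [h hf1 <-].
by exists h => // w; exact: le_trans (hf1 w) (f12 w).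
Qed.

(** The larger function is raised to infinity on a measurable null set that
    contains the exceptional points; its integral does not change. *)
Lemma ae_ge0_le_integral_nonmeasurable (f1 f2 : T -> \bar R) :
  (forall w, 0 <= f1 w) -> (forall w, 0 <= f2 w) -> measurable_fun setT f2 ->
  (\forall w \ae P, f1 w <= f2 w) ->
  \int[P]_w f1 w <= \int[P]_w f2 w.
Proof.
move=> f10 f20 mf2 [N [mN PN0 sN]].
have mNb : measurable_fun setT (fun w => w \in N).
  apply: (measurable_fun_bool true); rewrite setTI.
  rewrite (_ : _ @^-1` _ = N)//.
  by apply/seteqP; split => w /=; [exact: set_mem|exact: mem_set].
pose f3 w := if w \in N then +oo else f2 w.
have mf3 : measurable_fun setT f3 by apply: measurable_fun_ifT.
apply: (@le_trans _ _ (\int[P]_w f3 w)).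
  apply: ge0_le_integral_nonmeasurable => // w; rewrite /f3.
  case: ifPn => [_|/negP wN]; first by rewrite leey.
  by apply: contrapT => fw; apply: wN; rewrite inE; exact: sN.
rewrite le_eqVlt; apply/orP; left; apply/eqP.
apply: ae_eq_integral => //.
exists N; split => // w /= fw; apply: contrapT => wN; apply: fw => _.
by rewrite /f3 memNset.
Qed.

(** For D the regrets: the measurability of the projection, hence of D, never
    has to be established, since only its majorants g are exchanged with the
    series. *)
Lemma integral_series_le (D g : nat -> T -> R) (e : nat -> R) (S : R) :
  (forall n w, 0 <= D n w)%R -> (forall n w, 0 <= g n w)%R ->
  (forall n, bounded_rv (g n)) ->
  (\forall w \ae P, forall n, D n w <= g n w)%R ->
  (forall n, \int[P]_w g n w <= e n)%R ->
  (forall N, \sum_(i < N) e i <= S)%R ->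
  \int[P]_w (\sum_(0 <= i <oo) (D i w)%:E) <= S%:E.
Proof.
move=> D0 g0 bg Dg ge eS.
have mg n : measurable_fun setT (fun w => (g n w)%:E).
  by apply/measurable_EFinP; exact: (bg n).1.
apply: (@le_trans _ _ (\int[P]_w (\sum_(0 <= i <oo) (g i w)%:E))).
  apply: ae_ge0_le_integral_nonmeasurable.
  - by move=> w; apply: nneseries_ge0 => n _ _; rewrite lee_fin.
  - by move=> w; apply: nneseries_ge0 => n _ _; rewrite lee_fin.
  - by apply: ge0_emeasurable_sum => // n w _ _; rewrite lee_fin.
  - apply: filterS Dg => w Dgw; apply: lee_nneseries => n.
      by move=> _ _; rewrite lee_fin.
    by move=> _; rewrite lee_fin.
rewrite integral_nneseries//; last by move=> n w _; rewrite lee_fin.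
have gE n : \int[P]_w (g n w)%:E = (\int[P]_w g n w)%R%:E.
  by rewrite /Rintegral fineK//; apply: integrable_fin_num => //;
    exact: bounded_rv_integrable.
apply: lime_le.
  apply: is_cvg_nneseries => n _ _; apply: integral_ge0 => w _.
  by rewrite lee_fin.
apply: nearW => N; rewrite big_mkord.
under eq_bigr do rewrite gE.
rewrite sumEFin lee_fin; apply: le_trans (eS N).
by apply: ler_sum => i _; exact: ge.
Qed.

End domination.

(** * Suboptimality gaps *)

Section gaps.
Context (R : realType) (d : nat).
Implicit Types (a x : 'rV[R]_d).

Lemma minimumE (S : set R) m : S m -> lbound S m -> minimum S = m.
Proof.
move=> Sm lm.
have [Sg lg] : [set m | S m /\ lbound S m] (minimum S).
  by apply: (getPex (P := [set m | S m /\ lbound S m])); exists m.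
by apply/eqP; rewrite eq_le lg// lm.
Qed.

Lemma gapE a k j : (forall i, a 0 k <= a 0 i) -> gap a j = a 0 j - a 0 k.
Proof.
move=> ak; rewrite /gap dotp_coord_vec (minimumE (m := a 0 k))//.
  by exists k => //; rewrite dotp_coord_vec.
by move=> _ [i _ <-]; rewrite dotp_coord_vec.
Qed.

Lemma min_gapP a : (exists j, 0 < gap a j) ->
  0 < min_gap a /\ forall j, 0 < gap a j -> min_gap a <= gap a j.
Proof.
move=> [j0 j0P].
case: (arg_minP (P := fun j => 0 < gap a j) (gap a) j0P) => m mP m_min.
rewrite /min_gap (minimumE (m := gap a m))//; first by exists m.
by move=> _ [j jP <-]; exact: m_min.
Qed.

Lemma argmin_simplexE a xstar k : (forall i, a 0 k <= a 0 i) ->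
  argmin simplex (dotp a) xstar -> dotp a xstar = a 0 k.
Proof.
move=> ak [sx xmin]; apply/eqP; rewrite eq_le.
rewrite -{1}(dotp_coord_vec a k) xmin//=; last exact: coord_vec_simplex.
rewrite -subr_ge0 simplex_regretE//.
by apply: sumr_ge0 => j _; rewrite mulr_ge0 ?sx.1 ?subr_ge0.
Qed.

End gaps.

(** * Bounds for a single step *)

Section step_bounds.
Context (R : realType).
Variables (alpha Delta rho : R).
Hypothesis alpha_gt0 : 0 < alpha.
Hypothesis Delta_gt0 : 0 < Delta.
Hypothesis rho_gt0 : 0 < rho.

(** At round n, the polynomial p + q Q + t Q^2 in the squared norm Q of the
    noise majorizes every regret D compatible with [proj_simplex_regret], and e
    bounds its expectation through the bounds n rho^2 on the mean of Q and
    3 (n rho^2)^2 on the mean of Q^2. *)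
Definition step_bound (n e p q t : R) :=
  [/\ [/\ 0 <= p, 0 <= q & 0 <= t],
    forall delta Q D, 0 <= delta <= 1 -> 0 <= Q -> Delta * delta <= D ->
      D <= delta *
        ((1 - delta) * (alpha / Num.sqrt n) + Num.sqrt (2 * Q) / n) ->
      D <= p + q * Q + t * Q ^+ 2 &
    p + q * (n * rho ^+ 2) + t * (3 * (n * rho ^+ 2) ^+ 2) <= e].

Section step.
Variable n : R.
Hypothesis n_gt0 : 0 < n.

Let sn := Num.sqrt n.
Let sn_gt0 : 0 < sn. Proof. by rewrite sqrtr_gt0. Qed.
Let sn2 : sn ^+ 2 = n. Proof. by rewrite sqr_sqrtr// ltW. Qed.
Let r_gt0 : 0 < alpha / sn. Proof. by rewrite divr_gt0. Qed.

Let V_ge0 Q : 0 <= Num.sqrt (2 * Q) / n.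
Proof. by rewrite divr_ge0 ?sqrtr_ge0 ?ltW. Qed.

Let V2 Q : 0 <= Q -> (Num.sqrt (2 * Q) / n) ^+ 2 = 2 * Q / n ^+ 2.
Proof. by move=> Q0; rewrite exprMn sqr_sqrtr ?mulr_ge0// exprVn. Qed.

(* 17 / 12 is a rational upper bound of the square root of 2 *)
Let b := 17 / 12 * rho.
Let b_gt0 : 0 < b. Proof. by rewrite mulr_gt0. Qed.
Let b2 : 2 * rho ^+ 2 <= b ^+ 2.
Proof. by rewrite /b exprMn; have := sqr_ge0 rho; lra. Qed.

Let amgm (y u : R) : 0 < u -> y <= (y ^+ 2 / u + u) / 2.
Proof.
move=> u0; rewrite -subr_ge0.
have -> : (y ^+ 2 / u + u) / 2 - y = (y - u) ^+ 2 / (2 * u).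
  by field; rewrite gt_eqF.
by rewrite divr_ge0 ?sqr_ge0// mulr_ge0// ltW.
Qed.

(** The noise V is not a polynomial in Q; it is replaced by V^2 / (2 u) + u / 2,
    with u = b / sqrt n the typical size of V, which is what makes the
    expectation come out as if the mean of V were u. *)
Lemma step_bound_bias : exists p q t,
  step_bound n ((alpha / 4 + 17 / 12 * rho) / Num.sqrt n) p q t.
Proof.
pose u := b / sn; have u_gt0 : 0 < u by rewrite divr_gt0.
exists (alpha / sn / 4 + u / 2), ((n ^+ 2 * u)^-1), 0; split.
- split=> //; last by rewrite invr_ge0 mulr_ge0 ?exprn_ge0// ltW.
  by rewrite addr_ge0// divr_ge0// ltW.
- move=> delta Q D d01 Q0 _ /(regret_le_bias d01 (ltW r_gt0) (V_ge0 Q)) DV.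
  apply: (le_trans DV); have := amgm (Num.sqrt (2 * Q) / n) u_gt0.
  rewrite V2// => /(lerD (lexx (alpha / sn / 4)))/le_trans; apply.
  rewrite le_eqVlt; apply/orP; left; apply/eqP.
  by field; rewrite !gt_eqF.
- rewrite -/sn.
  have -> : (alpha / 4 + 17 / 12 * rho) / sn = alpha / sn / 4 + b / sn.
    by rewrite /b; field; rewrite gt_eqF.
  have -> : (n ^+ 2 * u)^-1 * (n * rho ^+ 2) = 2 * rho ^+ 2 / (2 * b * sn).
    by rewrite /u -sn2; field; rewrite !gt_eqF.
  have : 2 * rho ^+ 2 / (2 * b * sn) <= b ^+ 2 / (2 * b * sn).
    by rewrite ler_wpM2r// invr_ge0 !mulr_ge0// ltW.
  have -> : b ^+ 2 / (2 * b * sn) = b / sn / 2 by field; rewrite !gt_eqF.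
  by rewrite /u; lra.
Qed.

Lemma step_bound_square : exists p q t,
  step_bound n ((alpha + 17 / 12 * rho) ^+ 2 / (4 * alpha) / Num.sqrt n) p q t.
Proof.
pose u := b / sn; have u_gt0 : 0 < u by rewrite divr_gt0.
exists (alpha / sn / 4 + u / 4),
  ((2 * n ^+ 2 * u)^-1 + sn / (2 * alpha * n ^+ 2)), 0.
split.
- split=> //.
    by rewrite addr_ge0// divr_ge0// ltW.
  by apply: addr_ge0; apply: ltW; rewrite ?(mulr_gt0, invr_gt0, exprn_gt0).
- move=> delta Q D d01 Q0 _ /(regret_le_square r_gt0) DV.
  apply: (le_trans DV); have := amgm (Num.sqrt (2 * Q) / n) u_gt0.
  set V := Num.sqrt (2 * Q) / n => VV.
  have -> : (alpha / sn + V) ^+ 2 / (4 * (alpha / sn)) =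
      alpha / sn / 4 + V / 2 + V ^+ 2 * (sn / (4 * alpha)).
    by field; rewrite !gt_eqF.
  apply: (@le_trans _ _ (alpha / sn / 4 + (V ^+ 2 / u + u) / 2 / 2 +
     V ^+ 2 * (sn / (4 * alpha)))); first by lra.
  rewrite V2// le_eqVlt; apply/orP; left; apply/eqP.
  by field; rewrite !gt_eqF.
- rewrite -/sn.
  have -> : (alpha + 17 / 12 * rho) ^+ 2 / (4 * alpha) / sn =
      alpha / sn / 4 + b / sn / 2 + b ^+ 2 / (4 * alpha * sn).
    by rewrite /b; field; rewrite !gt_eqF.
  have -> : ((2 * n ^+ 2 * u)^-1 + sn / (2 * alpha * n ^+ 2)) * (n * rho ^+ 2) =
      2 * rho ^+ 2 / (4 * b * sn) + 2 * rho ^+ 2 / (4 * alpha * sn).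
    by rewrite /u -sn2; field; rewrite !gt_eqF.
  have : 2 * rho ^+ 2 / (4 * b * sn) <= b ^+ 2 / (4 * b * sn).
    by rewrite ler_wpM2r// invr_ge0 !mulr_ge0// ltW.
  have : 2 * rho ^+ 2 / (4 * alpha * sn) <= b ^+ 2 / (4 * alpha * sn).
    by rewrite ler_wpM2r// invr_ge0 !mulr_ge0// ltW.
  have -> : b ^+ 2 / (4 * b * sn) = b / sn / 4 by field; rewrite !gt_eqF.
  by rewrite /u; lra.
Qed.

Lemma step_bound_tail (s : R) : 0 < s -> ((alpha + s) / Delta) ^+ 2 < n ->
  exists p q t, step_bound n
    (12 * rho ^+ 4 * (1 + alpha / (4 * s)) * ((alpha + s) / (s * Delta)) ^+ 3 /
      n ^+ 2) p q t.
Proof.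
move=> s_gt0 nX.
set K := (1 + alpha / (4 * s)) * ((alpha + s) / (s * Delta)) ^+ 3.
have K_ge0 : 0 <= K.
  by rewrite mulr_ge0 ?exprn_ge0 ?addr_ge0 ?divr_ge0 ?mulr_ge0 ?addr_ge0// ltW.
have c_sn : (alpha + s) / Delta <= sn.
  rewrite -ler_sqr ?nnegrE ?divr_ge0 ?addr_ge0 ?ltW//.
  by rewrite sn2.
have rD : alpha / sn * (alpha + s) <= alpha * Delta.
  rewrite mulrAC ler_pdivrMr// -mulrA (ler_wpM2l (ltW alpha_gt0))//.
  by rewrite mulrC -ler_pdivrMr.
exists 0, 0, (4 * K / n ^+ 4); split.
- by split=> //; apply: divr_ge0; [exact: mulr_ge0|exact/exprn_ge0/ltW].
- move=> delta Q D d01 Q0 De DV.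
  apply: le_trans (regret_le_quartic d01 (ltW r_gt0) (V_ge0 Q) Delta_gt0
    (ltW alpha_gt0) s_gt0 rD De DV) _.
  rewrite -/K -[4%N]/(2 * 2)%N exprM V2//.
  rewrite le_eqVlt; apply/orP; left; apply/eqP.
  by field; rewrite gt_eqF.
- rewrite le_eqVlt; apply/orP; left; apply/eqP.
  rewrite -[12 * _ * _ * _]mulrA -/K.
  by field; rewrite gt_eqF.
Qed.

End step.

(** Rounds up to ((alpha + s) / Delta)^2 are charged to the early bound, and
    later rounds to the smaller of the two bounds; the threshold is where the
    bias alpha / sqrt n falls to the fraction alpha / (alpha + s) of Delta. *)
Lemma step_bounds (A s : R) : 0 < s -> 0 <= A ->
  (forall n : R, 0 < n -> exists p q t, step_bound n (A / Num.sqrt n) p q t) ->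
  exists (e p q t : nat -> R),
    (forall n, step_bound n.+1%:R (e n) (p n) (q n) (t n)) /\
    forall N, \sum_(i < N) e i <=
      (2 * A * (alpha + s) + 12 * rho ^+ 4 * (1 + alpha / (4 * s)) *
        (alpha + s) / s ^+ 3) / Delta.
Proof.
move=> s_gt0 A_ge0 early.
pose X := ((alpha + s) / Delta) ^+ 2.
pose B := 12 * rho ^+ 4 * (1 + alpha / (4 * s)) *
  ((alpha + s) / (s * Delta)) ^+ 3.
have c_gt0 : 0 < alpha + s by rewrite addr_gt0.
have X_gt0 : 0 < X by rewrite exprn_gt0// divr_gt0.
have B_ge0 : 0 <= B.
  by apply: ltW; rewrite ?(mulr_gt0, invr_gt0, exprn_gt0, addr_gt0).
have /choice[f fP] : forall n : nat, exists f : R * R * R * R,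
    [/\ step_bound n.+1%:R f.1.1.1 f.1.1.2 f.1.2 f.2,
      f.1.1.1 <= A / Num.sqrt n.+1%:R &
      X < n.+1%:R -> f.1.1.1 <= B / n.+1%:R ^+ 2].
  move=> n; have n_gt0 : 0 < n.+1%:R :> R by rewrite ltr0n.
  have [p [q [t E]]] := early _ n_gt0.
  have [nX|Xn] := leP n.+1%:R X.
    by exists (A / Num.sqrt n.+1%:R, p, q, t).
  have [p' [q' [t' E']]] := step_bound_tail n_gt0 s_gt0 Xn.
  have [AB|BA] := leP (A / Num.sqrt n.+1%:R) (B / n.+1%:R ^+ 2).
    by exists (A / Num.sqrt n.+1%:R, p, q, t).
  by exists (B / n.+1%:R ^+ 2, p', q', t'); split => //=; exact: ltW.
exists (fun n => (f n).1.1.1), (fun n => (f n).1.1.2), (fun n => (f n).1.2),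
  (fun n => (f n).2); split=> [n|N]; first by case: (fP n).
have eA n : (f n).1.1.1 <= A / Num.sqrt n.+1%:R by case: (fP n).
have eB n : X < n.+1%:R -> (f n).1.1.1 <= B / n.+1%:R ^+ 2 by case: (fP n).
apply: le_trans (sum_two_regimes A_ge0 B_ge0 X_gt0 eA eB N) _.
rewrite sqrtr_sqr ger0_norm; last by apply: ltW; rewrite divr_gt0.
rewrite le_eqVlt; apply/orP; left; apply/eqP.
by rewrite /B /X; field; rewrite !gt_eqF.
Qed.

End step_bounds.

(** * Expected regret *)

Section stochastic_regret.
Context d0 (T : measurableType d0) (R : realType) (P : probability T R).
Context (d : nat) (A : nat -> {RV P >-> 'rV[R]_d}) (a xstar : 'rV[R]_d).
Variables (L r eta : R).
Hypothesis indA : mutually_independent A.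
Hypothesis meanA : forall i j,
  ('E_P[fun w : T => (A i w 0 j)%R] = (a 0 j)%:E)%E.
Hypothesis L_gt0 : 0 < L.
Hypothesis r_gt0 : 0 < r.
Hypothesis AL : forall i, \forall w \ae P, enorm (A i w) <= L.
Hypothesis Ar : forall i, \forall w \ae P, enorm (A i w - a) <= r.
Hypothesis eta_gt0 : 0 < eta.
Hypothesis xstarP : argmin simplex (dotp a) xstar.
Hypothesis gap_pos : exists j, 0 < gap a j.

Let x n w := anytime_subgradient simplex eta (fun i => A i w) n.
Let rho := Num.min L r.

(** The first round costs at most |a| times the diameter sqrt 2 of the simplex.
    The other rounds are majorized by polynomials in the squared norms Q of the
    partial sums of centered costs, whose first two moments are known. *)
Lemma expected_regret_le (C s : R) : 0 < s -> 0 <= C ->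
  (forall n : R, 0 < n ->
    exists p q t, step_bound eta^-1 (min_gap a) rho n (C / Num.sqrt n) p q t) ->
  (\int[P]_w (\sum_(0 <= i <oo) (dotp a (x i w - xstar))%:E) <=
    (Num.sqrt 2 * L + (2 * C * (eta^-1 + s) +
      12 * rho ^+ 4 * (1 + eta^-1 / (4 * s)) * (eta^-1 + s) / s ^+ 3) /
      min_gap a)%:E)%E.
Proof.
move=> s_gt0 C_ge0 early.
have rho_gt0 : 0 < rho by rewrite lt_min L_gt0.
have alpha_gt0 : 0 < eta^-1 by rewrite invr_gt0.
have [Delta_gt0 DeltaP] := min_gapP gap_pos.
have [e [p [q [t [ept eS]]]]] :=
  step_bounds alpha_gt0 Delta_gt0 rho_gt0 s_gt0 C_ge0 early.
have [B [[mB indB meanB] BL Br AB]] :=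
  bounded_modification L_gt0 r_gt0 indA meanA AL Ar.
have [j0 _] := gap_pos.
case: (arg_minP (P := predT) (fun j => a 0 j) (i0 := j0) isT) => k _ ak.
have {}ak j : a 0 k <= a 0 j by exact: ak.
have ak_gap j : a 0 k < a 0 j -> min_gap a <= a 0 j - a 0 k.
  by move=> jk; rewrite -(gapE j ak) DeltaP// (gapE j ak) subr_gt0.
have ne : exists x : 'rV[R]_d, simplex x.
  by exists (coord_vec R k); exact: coord_vec_simplex.
have sx n w : simplex (x n w).
  by case: n => [|n]; exact: (proj_simplexP _ ne).1.
have DE n w : dotp a (x n w - xstar) = dotp a (x n w) - a 0 k.
  by rewrite dotpDr dotpNr (argmin_simplexE ak xstarP).
(* the centred costs, their partial sums and the squared norms of these *)
pose X i w := B i w - a.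
pose Q n w := dotp (\sum_(i < n) X i w) (\sum_(i < n) X i w).
have subE (v : 'rV[R]_d) j : (v - a) 0 j = v 0 j - a 0 j by rewrite !mxE.
have msub : measurable_fun setT (fun v : 'rV[R]_d => v - a).
  by apply: measurable_addrV.
have mX i : measurable_fun setT (X i) by exact: (measurableT_comp msub (mB i)).
have indX (J : {fset nat}) (F : nat -> set 'rV[R]_d) :
    (forall i, measurable (F i)) ->
    (P (\bigcap_(i in [set` J]) (X i @^-1` F i)) =
    \prod_(i <- J) P (X i @^-1` F i))%E.
  move=> mF; apply: (indB J (fun i => (fun v => v - a) @^-1` F i)) => i.
  by rewrite -[Y in measurable Y]setTI; exact: msub.
have bB i j : bounded_rv (fun w => B i w 0 j).
  split; first exact: measurable_coord_comp.
  by exists L => w; rewrite (le_trans (normr_coord_le_enorm _ _)).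
have bX i j : bounded_rv (fun w => X i w 0 j).
  rewrite (_ : (fun w => _) = (fun w => B i w 0 j + (- a 0 j))).
    by apply: bounded_rvD => //; exact: bounded_rv_cst.
  by apply/funext => w; rewrite subE.
have cX i j : \int[P]_w X i w 0 j = 0.
  under eq_Rintegral do rewrite subE.
  rewrite Rintegral_bounded_rvD//; last exact: bounded_rv_cst.
  by rewrite meanB Rintegral_prob_cst subrr.
have X2 i := second_moment_centered (mB i) L_gt0 r_gt0 (BL i) (Br i) (meanB i).
have X4 i := fourth_moment_centered (mB i) L_gt0 r_gt0 (BL i) (Br i) (meanB i).
have Q2 := second_moment_sum mX indX bX cX X2.
have Q4 := fourth_moment_sum mX indX bX cX X2 X4.
have bQ n : bounded_rv (Q n).
  have bG j : bounded_rv (fun w => (\sum_(i < n) X i w) 0 j).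
    under eq_fun do rewrite summxE.
    exact: bounded_rv_sum.
  by apply: bounded_rv_sum => j; exact: bounded_rvM.
pose g n w := if n is m.+1 then p m + q m * Q n w + t m * Q n w ^+ 2
  else Num.sqrt 2 * L.
pose e' n := if n is m.+1 then e m else Num.sqrt 2 * L.
apply: (@integral_series_le _ _ _ _ _ g e').
- move=> n w; rewrite DE simplex_regretE//.
  by apply: sumr_ge0 => j _; rewrite mulr_ge0 ?subr_ge0//; exact: (sx n w).1.
- case=> [|n] w; first by rewrite mulr_ge0 ?sqrtr_ge0// ltW.
  have [[p0 q0 t0] _ _] := ept n.
  by rewrite !addr_ge0// mulr_ge0 ?sqr_ge0 ?dotp_ge0.
- case=> [|n]; first exact: bounded_rv_cst.
  apply: bounded_rvD; last by apply: bounded_rvZ; exact: bounded_rvX.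
  by apply: bounded_rvD; [exact: bounded_rv_cst|exact: bounded_rvZ].
- apply: filterS AB => w ABw [|n].
    apply: le_trans (ler_norm _) _; apply: le_trans (cauchy_schwarz _ _) _.
    rewrite mulrC ler_pM ?enorm_ge0//; last first.
      exact: (enorm_mean_le (mB 0%N) L_gt0 (BL 0%N) (meanB 0%N)).
    by rewrite /enorm ler_wsqrtr// simplex_diameter//; case: xstarP.
  have n_gt0 : 0 < n.+1%:R :> R by rewrite ltr0n.
  pose sn := Num.sqrt (n.+1%:R : R).
  have sn_gt0 : 0 < sn by rewrite sqrtr_gt0.
  have sn2 : sn ^+ 2 = n.+1%:R by rewrite sqr_sqrtr// ltW.
  have xP : argmin simplex (fun z => enorm (- ((eta * sn) *: a) -
      (eta / sn) *: (\sum_(i < n.+1) X i w) - z)) (x n.+1 w).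
    rewrite /x/= -/sn.
    suff -> : - (eta *: (sn^-1 *: \sum_(i < n.+1) A i w)) =
        - ((eta * sn) *: a) - (eta / sn) *: (\sum_(i < n.+1) X i w).
      exact: proj_simplexP.
    rewrite -opprD scalerA; congr (- _).
    have -> : \sum_(i < n.+1) A i w = sn ^+ 2 *: a + \sum_(i < n.+1) X i w.
      rewrite /X sumrB sumr_const card_ord sn2 scaler_nat addrCA subrr addr0.
      by apply: eq_bigr => i _.
    rewrite scalerDr scalerA; congr (_ *: _ + _).
    by field; rewrite gt_eqF.
  have [delta [d01 De DV]] := proj_simplex_regret ak ak_gap sn_gt0 eta_gt0 xP.
  have [_ maj _] := ept n.
  rewrite sn2 in DV; rewrite DE.
  by apply: maj d01 _ De DV; exact: dotp_ge0.
- case=> [|n]; first by rewrite Rintegral_prob_cst.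
  have [[p0 q0 t0] _ le_e] := ept n.
  apply: le_trans le_e.
  rewrite Rintegral_bounded_rvD; last 2 first.
    by apply: bounded_rvD; [exact: bounded_rv_cst|exact: bounded_rvZ].
    by apply: bounded_rvZ; exact: bounded_rvX.
  rewrite Rintegral_bounded_rvD; [|exact: bounded_rv_cst|exact: bounded_rvZ].
  rewrite (Rintegral_bounded_rvZ P (q n) (bQ n.+1)).
  rewrite (Rintegral_bounded_rvZ P (t n) (bounded_rvX 2 (bQ n.+1))).
  rewrite Rintegral_prob_cst.
  by rewrite !lerD// ler_wpM2l//; [exact: Q2|exact: Q4].
- case=> [|N]; last first.
    by rewrite big_ord_recl/= lerD2l; exact: eS.
  rewrite big_ord0; apply: addr_ge0; first by rewrite mulr_ge0 ?sqrtr_ge0 ?ltW.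
  by have := eS 0%N; rewrite big_ord0.
Qed.

End stochastic_regret.

Lemma budget_exponential (R : realType) (eta L r : R) :
  0 < eta -> 0 < L -> 0 < r ->
  eta^-1 <= 2 * Num.min L r ->
  10^-1 <= expR (- (1 / (2 * eta ^+ 2 * r ^+ 2))).
Proof.
move=> eta_gt0 L_gt0 r_gt0 le2.
apply: le_trans (expRN2_ge R) _; rewrite ler_expR lerN2.
have er : 1 <= 2 * (eta * r).
  have /(ler_wpM2l (ltW eta_gt0)) : eta^-1 <= 2 * r.
    by apply: le_trans le2 _; rewrite ler_pM2l// ge_min lexx orbT.
  by rewrite divff ?gt_eqF//; lra.
rewrite ler_pdivrMr ?mulr_gt0 ?exprn_gt0//.
nra.
Qed.

Theorem theorem2 (R : realType) (disp : measure_display)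
    (T : measurableType disp) (P : probability T R) (d : nat)
    (A : nat -> {RV P >-> 'rV[R]_d}) (a xstar : 'rV[R]_d) (L2 R2 eta : R)
    (A_iid : iid A)
    (A_mean : forall (i : nat) (j : 'I_d),
      ('E_P[fun w : T => (A i w 0 j)%R] = (a 0 j)%:E)%E)
    (L2_gt0 : 0 < L2) (R2_gt0 : 0 < R2)
    (A_bound : forall i : nat, \forall w \ae P, enorm (A i w) <= L2)
    (A_dev : forall i : nat, \forall w \ae P, enorm (A i w - a) <= R2)
    (eta_gt0 : 0 < eta)
    (xstar_argmin : argmin simplex (dotp a) xstar)
    (gap_pos : exists j : 'I_d, 0 < gap a j) :
  let x (n : nat) (w : T) : 'rV[R]_d :=
    anytime_subgradient simplex eta (fun i : nat => A i w) n in
  let Delta : R := min_gap a in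
  let expected_regret : \bar R :=
    (\int[P]_w (\sum_(0 <= i <oo) (dotp a (x i w - xstar))%:E))%E in
  (expected_regret <=
    (Num.sqrt 2 * L2 + (1 + 2 * eta ^+ 2 * L2 ^+ 2) * L2 / 6 +
     (3 / eta ^+ 2 + 6 * L2 ^+ 2 +
      72 * R2 ^+ 2 * expR (- (1 / (2 * eta ^+ 2 * R2 ^+ 2)))) / Delta)%:E)%E
  /\
  (eta = 1 / (2 * L2) ->
   (expected_regret <=
     (2 * L2 + (18 * L2 ^+ 2 + 72 * R2 ^+ 2) / Delta)%:E)%E).
Proof.
move=> x Delta expected_regret.
have [Delta_gt0 _] := min_gapP gap_pos; rewrite -/Delta in Delta_gt0.
set E := expR _.
have E_ge0 : 0 <= E := expR_ge0 _.
pose rho := Num.min L2 R2.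
have rho_gt0 : 0 < rho by rewrite lt_min L2_gt0.
have rhoL : rho ^+ 2 <= L2 ^+ 2.
  by rewrite ler_sqr ?nnegrE ?(ltW rho_gt0) ?(ltW L2_gt0)// ge_min lexx.
have rhoR : rho ^+ 2 <= R2 ^+ 2.
  by rewrite ler_sqr ?nnegrE ?(ltW rho_gt0) ?(ltW R2_gt0)// ge_min lexx orbT.
have rhoE : 72 * rho ^+ 2 * E <= 72 * R2 ^+ 2 * E.
  by rewrite ler_wpM2r// ler_pM2l.
have alpha_gt0 : 0 < eta^-1 by rewrite invr_gt0.
have alpha2 : 3 / eta ^+ 2 = 3 * eta^-1 ^+ 2 by rewrite exprVn.
have core : (expected_regret <= (Num.sqrt 2 * L2 +
    (3 / eta ^+ 2 + 6 * L2 ^+ 2 + 72 * R2 ^+ 2 * E) / Delta)%:E)%E.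
  (* the exponential term is used only in the first case *)
  have [small|large] := leP eta^-1 (2 * rho).
    apply: le_trans (expected_regret_le (s := 2 * rho)
      (C := eta^-1 / 4 + 17 / 12 * rho)
      A_iid.1 A_mean L2_gt0 R2_gt0 A_bound A_dev eta_gt0 xstar_argmin gap_pos
      _ _ _) _.
    - by rewrite mulr_gt0.
    - by apply: ltW; rewrite addr_gt0// mulr_gt0.
    - by move=> n n_gt0; exact: step_bound_bias.
    rewrite lee_fin lerD2l ler_wpM2r ?invr_ge0 ?(ltW Delta_gt0)//.
    have E10 := budget_exponential eta_gt0 L2_gt0 R2_gt0 small.
    apply: le_trans (short_horizon_budget rho_gt0 alpha_gt0 E10) _.
    by rewrite alpha2 -/E; lra.
  apply: le_trans (expected_regret_le (s := 3 * rho)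
    (C := (eta^-1 + 17 / 12 * rho) ^+ 2 / (4 * eta^-1))
    A_iid.1 A_mean L2_gt0 R2_gt0 A_bound A_dev eta_gt0 xstar_argmin gap_pos
    _ _ _) _.
  - by rewrite mulr_gt0.
  - by rewrite divr_ge0 ?sqr_ge0// mulr_ge0// ltW.
  - by move=> n n_gt0; exact: step_bound_square.
  rewrite lee_fin lerD2l ler_wpM2r ?invr_ge0 ?(ltW Delta_gt0)//.
  apply: le_trans (long_horizon_budget rho_gt0 (ltW large)) _.
  have : 0 <= 72 * rho ^+ 2 * E by rewrite mulr_ge0// mulr_ge0 ?sqr_ge0.
  by rewrite alpha2; lra.
split; last move=> etaE; apply: (le_trans core); rewrite lee_fin.
  rewrite lerD2r lerDl divr_ge0// mulr_ge0 ?(ltW L2_gt0)//.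
  by rewrite addr_ge0// mulr_ge0 ?sqr_ge0// mulr_ge0 ?sqr_ge0.
apply: lerD.
  rewrite ler_wpM2r ?(ltW L2_gt0)//.
  by rewrite -ler_sqr ?nnegrE ?sqrtr_ge0// sqr_sqrtr//; lra.
rewrite ler_wpM2r ?invr_ge0 ?(ltW Delta_gt0)//.
have -> : 3 / eta ^+ 2 = 12 * L2 ^+ 2.
  by rewrite etaE; field; rewrite gt_eqF.
have E1 : E <= 1.
  rewrite /E -[leRHS]expR0 ler_expR oppr_le0.
  by rewrite divr_ge0// mulr_ge0 ?sqr_ge0// mulr_ge0 ?sqr_ge0.
have : R2 ^+ 2 * E <= R2 ^+ 2 by rewrite ler_piMr ?sqr_ge0.
lra.
Qed.
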